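(* Let $b>0$ and let $L=(L_t:t\ge 0)$ be a L\'evy subordinator with Laplace exponent $\psi(x)=-\log\mathbb{E}e^{-xL_1}$. For each $n\ge 1$ consider a mixed coherent system with $n$ components and signature vector $s^{(n)}=(s^{(n)}_1,\dots,s^{(n)}_n)$ given by $$s^{(n)}_k=C^{(n)}(n-k+1)^{b-1},\qquad k=1,\dots,n,$$ where $C^{(n)}$ is the constant that makes $\sum_{k=1}^n s^{(n)}_k=1$. Assume the component failure times follow the L\'evy-frailty Marshall-Olkin distribution on $\mathbb{R}^n$ with underlying subordinator $L$, common for all $n$, and let $T_{\mathrm{sys}}^{(n)}$ be the failure time of the system with $n$ components. Then for all $t>0$, $$\mathbb{P}\big(T_{\mathrm{sys}}^{(n)}>t\big)\to\mathbb{P}\big(e_{\psi(b)}>t\big)\qquad\text{as }n\to+\infty,$$ where $e_{\psi(b)}$ is an exponential random variable with rate $\psi(b)$. In particular, the reliability function $R^{(n)}(t)=\mathbb{P}(T_{\mathrm{sys}}^{(n)}>t)$ converges to $e^{-\psi(b)t}$. Moreover, in the limit the system fails when a random proportion $Q$ of the components have failed, where $Q$ has distribution $\mathrm{beta}(1,b)$, in the following sense: if $Q_n$ is a random variable with $\mathbb{P}(Q_n=k/(n+1))=s^{(n)}_k$, $k=1,\dots,n$, then $Q_n$ converges in distribution to a $\mathrm{beta}(1,b)$ random variable $Q$.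
   Context: Simplex: $\Delta^n=\{p\in\mathbb{R}^n: p\ge 0,\ \sum_i p_i=1\}$. For $x\in\{0,1\}^n$, $|x|=\sum_i x_i$. L\'evy subordinator: a real-valued L\'evy process (c\`adl\`ag, stationary independent increments) with nondecreasing paths and $L_0=0$. Coherent systems. A system with $n$ components has a structure function $\Phi:\{0,1\}^n\to\{0,1\}$; $x_i=1$ means component $i$ works, and $\Phi(x)=1$ means the system works. Component $i$ is irrelevant if $\Phi(x|_{x_i=0})=\Phi(x|_{x_i=1})$ for all $x$, where $x|_{x_i=y}$ is $x$ with its $i$-th entry replaced by $y$. The system is monotone if $\Phi(x|_{x_i=0})\le\Phi(x|_{x_i=1})$ for all $i$ and all $x$. It is coherent if it is monotone and has no irrelevant component. Mixed coherent systems. A mixed coherent system of size $n$ is a random choice among the finitely many coherent systems of size $n$: if $\Phi^1,\dots,\Phi^m$ are all the structure functions of coherent systems of size $n$ and $(p^1,\dots,p^m)$ is a probability vector, its structure function $\Phi$ is random, equal to $\Phi^j$ with probability $p^j$; this random choice is independent of the component failure times. Its signature is $s\in\Delta^n$ with $s_k=\phi_{n-k+1}-\phi_{n-k}$, $k=1,\dots,n$, where $\phi_{n-k}=\binom{n}{n-k}^{-1}\sum_{x\in\{0,1\}^n,\,|x|=n-k}\mathbb{E}\,\Phi(x)$. L\'evy-frailty Marshall-Olkin (LFMO) distribution on $\mathbb{R}^n$ with underlying subordinator $L$: the law of $(T_1,\dots,T_n)$ with $T_i=\inf\{t\ge 0: L_t>\varepsilon_i\}$, where $\varepsilon_1,\dots,\varepsilon_n$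 are i.i.d. standard exponential (rate 1) random variables independent of $L$. System failure time: components are non-repairable, component $i$ works at time $t$ iff $T_i>t$, and $T_{\mathrm{sys}}^{(n)}$ is the first time at which the system stops working, i.e. $T_{\mathrm{sys}}^{(n)}=\inf\{t\ge 0:\Phi(\mathbf 1_{\{T_1>t\}},\dots,\mathbf 1_{\{T_n>t\}})=0\}$. Conventions: $\inf\emptyset=+\infty$; an exponential random variable of rate $0$ is $+\infty$ almost surely. The $\mathrm{beta}(1,b)$ distribution has density $b(1-q)^{b-1}$ on $(0,1)$. *)

(* Defs.v *)
From HB Require Import structures.
From mathcomp Require Export all_boot all_order all_algebra.
From mathcomp Require Export all_classical all_reals all_analysis.
From mathcomp Require Export measurable_realfun.
Export Order.TTheory GRing.Theory Num.Theory.
Export numFieldNormedType.Exports.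

Set Implicit Arguments.
Unset Strict Implicit.
Unset Printing Implicit Defensive.

Local Open Scope classical_set_scope.
Local Open Scope ring_scope.

Section Independence.
Context d (Omega : measurableType d) (R : realType) (P : probability Omega R).
Context d' (E : measurableType d').

Definition mutually_independent (I : finType) (X : I -> Omega -> E) : Prop :=
  forall B : I -> set E, (forall i, measurable (B i)) ->
    P [set w | forall i, B i (X i w)] =
    (\prod_(i : I) P (X i @^-1` B i))%E.

Definition sigma_generated (I : Type) (D : set I) (X : I -> Omega -> E) :
    set (set Omega) :=
  <<s \bigcup_(i in D) preimage_set_system setT (X i) measurable >>.

End Independence.

Section Processes.
Context d (Omega : measurableType d) (R : realType) (P : probability Omega R).

(* Time runs over [0, +oo[: the variables L t with t < 0 are unconstrained and
   are never used. *)
Record levy_subordinator (L : R -> {RV P >-> R}) : Prop := LevySubordinator {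
  subordinator_start : forall w, L 0 w = 0 ;
  subordinator_nondecreasing :
    forall w (s t : R), 0 <= s -> s <= t -> L s w <= L t w ;
  subordinator_right_continuous :
    forall w (t : R), 0 <= t -> L u w @[u --> t^'+] --> L t w ;
  subordinator_left_limits :
    forall w (t : R), 0 < t -> cvg (L u w @[u --> t^'-]) ;
  subordinator_stationary :
    forall s h : R, 0 <= s -> 0 <= h -> forall B : set R, measurable B ->
      P [set w | B (L (s + h) w - L s w)] = P [set w | B (L h w - L 0 w)] ;
  subordinator_independent :
    forall (k : nat) (t : nat -> R), 0 <= t 0%N ->
      (forall i j, (i <= j)%N -> t i <= t j) ->
      mutually_independent P
        (fun (i : 'I_k) (w : Omega) => L (t i.+1) w - L (t i) w) }.

Definition laplace_exponent (L : R -> {RV P >-> R}) (x : R) : R :=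
  - ln (fine 'E_P[fun w => expR (- x * L 1 w)]).

End Processes.

Definition same_law d1 d2 d' (O1 : measurableType d1) (O2 : measurableType d2)
    (E : measurableType d') (R : realType)
    (P1 : probability O1 R) (P2 : probability O2 R)
    (X : O1 -> E) (Y : O2 -> E) : Prop :=
  forall A : set E, measurable A -> P1 (X @^-1` A) = P2 (Y @^-1` A).

Definition joint (Omega E : Type) (n : nat) (X : 'I_n -> Omega -> E)
    (w : Omega) : n.-tuple E :=
  [tuple X i w | i < n].

Definition same_process_law (R : realType) d1 d2
    (O1 : measurableType d1) (O2 : measurableType d2)
    (P1 : probability O1 R) (P2 : probability O2 R)
    (L1 : R -> {RV P1 >-> R}) (L2 : R -> {RV P2 >-> R}) : Prop :=
  forall (k : nat) (t : 'I_k -> R), (forall i, 0 <= t i) ->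
    same_law P1 P2 (joint (fun i => L1 (t i) : O1 -> R))
                   (joint (fun i => L2 (t i) : O2 -> R)).

Definition lfmo_time (R : realType) (Omega : Type) (L : R -> Omega -> R)
    (eps : Omega -> R) (w : Omega) : \bar R :=
  ereal_inf [set t%:E | t in [set t : R | 0 <= t /\ eps w < L t w]].

(* The law depends on L only through the law of the process, so the
   construction is carried out on an auxiliary probability space supporting a
   copy L' of L together with the exponential thresholds. *)
Definition LFMO (R : realType) (n : nat)
    dL (OL : measurableType dL) (PL : probability OL R)
    (L : R -> {RV PL >-> R})
    d (Omega : measurableType d) (P : probability Omega R)
    (T : 'I_n -> {RV P >-> \bar R}) : Prop :=
  exists d' (O' : measurableType d') (P' : probability O' R)
      (L' : R -> {RV P' >-> R}) (eps : 'I_n -> {RV P' >-> R}),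
    [/\ levy_subordinator L' /\ same_process_law L L',
        forall (i : 'I_n) (A : set R), measurable A ->
          distribution P' (eps i) A = exponential_prob 1 A,
        mutually_independent P' (fun i => eps i : O' -> R),
        forall A B : set O',
          sigma_generated [set t : R | 0 <= t] (fun t => L' t : O' -> R) A ->
          sigma_generated setT (fun i => eps i : O' -> R) B ->
          P' (A `&` B) = (P' A * P' B)%E
      & same_law P P' (joint (fun i => T i : Omega -> \bar R))
          (joint (fun i => lfmo_time (fun t => L' t : O' -> R) (eps i)))].

Definition state (n : nat) := {ffun 'I_n -> bool}.
Definition structure_function (n : nat) := {ffun state n -> bool}.

Definition set_component n (x : state n) (i : 'I_n) (y : bool) : state n :=
  [ffun j => if j == i then y else x j].

Definition irrelevant n (Phi : structure_function n) (i : 'I_n) : bool :=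
  [forall x, Phi (set_component x i false) == Phi (set_component x i true)].

Definition monotone n (Phi : structure_function n) : bool :=
  [forall i, forall x,
    Phi (set_component x i false) ==> Phi (set_component x i true)].

Definition coherent n (Phi : structure_function n) : bool :=
  monotone Phi && [forall i, ~~ irrelevant Phi i].

Definition coherent_system (n : nat) :=
  {Phi : structure_function n | coherent Phi}.

Section MixedSystems.
Context (R : realType) d (Omega : measurableType d) (P : probability Omega R).
Context (n : nat).
Implicit Types (Phi : Omega -> coherent_system n) (T : 'I_n -> {RV P >-> \bar R}).

Definition mixed_coherent_system Phi : Prop :=
  exists p : coherent_system n -> R,
    [/\ forall phi, 0 <= p phi,
        \sum_phi p phi = 1
      & forall phi, measurable [set w | Phi w = phi] /\
                    P [set w | Phi w = phi] = (p phi)%:E].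

Definition choice_independent_of_times Phi T : Prop :=
  forall phi (A : set (n.-tuple (\bar R))), measurable A ->
    P ([set w | Phi w = phi] `&`
       joint (fun i => T i : Omega -> \bar R) @^-1` A) =
    (P [set w | Phi w = phi] *
     P (joint (fun i => T i : Omega -> \bar R) @^-1` A))%E.

Definition mean_structure Phi (j : nat) : R :=
  ('C(n, j)%:R)^-1 *
  \sum_(x : state n | (\sum_i x i)%N == j)
     fine 'E_P[fun w => (sval (Phi w) x)%:R].

Definition signature Phi (k : nat) : R :=
  mean_structure Phi (n - k + 1) - mean_structure Phi (n - k).

Definition system_failure_time Phi T (w : Omega) : \bar R :=
  ereal_inf [set t%:E | t in [set t : R |
    0 <= t /\ sval (Phi w) [ffun i => (t%:E < T i w)%E] = false]].

End MixedSystems.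

Definition exponential_rv (R : realType) d (Omega : measurableType d)
    (P : probability Omega R) (e : {RV P >-> \bar R}) (r : R) : Prop :=
  if r == 0 then P [set w | e w = +oo%E] = 1%E
  else forall A : set (\bar R), measurable A ->
         distribution P e A = exponential_prob r (EFin @^-1` A).

(* The library's beta distribution only covers integer parameters. *)
Definition beta1_pdf (R : realType) (b : R) : R -> R :=
  (fun q : R => b * (1 - q) `^ (b - 1)) \_ `]0, 1[.

Definition beta1_rv (R : realType) d (Omega : measurableType d)
    (P : probability Omega R) (Q : {RV P >-> R}) (b : R) : Prop :=
  forall A : set R, measurable A ->
    distribution P Q A =
    (\int[lebesgue_measure]_(q in A) (beta1_pdf b q)%:E)%E.

Definition cvg_in_distribution (R : realType)
    (d : nat -> measure_display) (Omega : forall n, measurableType (d n))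
    (P : forall n, probability (Omega n) R) (X : forall n, {RV (P n) >-> R})
    d' (Omega' : measurableType d') (P' : probability Omega' R)
    (Y : {RV P' >-> R}) : Prop :=
  forall x : R, {for x, continuous (cdf Y)} ->
    cdf (X n) x @[n --> \oo] --> cdf Y x.

(* Main.v *)
Require Import Defs.
From mathcomp Require Import ring lra zify.

(** Given the subordinator, the components work at time [t] independently with
    probability [p = exp (- L t)], so the survival probability of a mixed system
    is the expectation of the Bernstein polynomial of its mean structure
    evaluated at [p].  The signature forces the mean structure at [j] to be
    [S j / S n] with [S j = \sum_(1 <= i <= j) i `^ (b - 1)], which is uniformly
    close to [(j / n) `^ b] by comparing [b * S j] with [j `^ b] through the mean
    value theorem.  By Chebyshev's inequality the Bernstein polynomials then
    converge uniformly to [p `^ b], whose expectation is the Laplace transform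
    of [L t] at [b], and this is exponential in [t] by independence and
    stationarity of the increments.  The distribution function of [Q_n] is one
    minus the mean structure, whence the beta limit. *)

Local Open Scope classical_set_scope.
Local Open Scope ring_scope.

Set Implicit Arguments.
Unset Strict Implicit.
Unset Printing Implicit Defensive.

(** * Power sums *)

Local Open Scope classical_set_scope.
Local Open Scope ring_scope.

(** The sign of [b - 1] is arbitrary, so the summand of [powsum] may increase or decrease. The
    estimates therefore use absolute differences of powers, for which only monotonicity matters, and
    the modulus of continuity of the limit is Hoelder for [b <= 1] and Lipschitz for [b >= 1]. Every
    bound must be uniform in [p], because [p] is the random value [expR (- L t)] and the error is
    afterwards integrated over it. Two facts connect the failure times with Bernoulli states. A
    component outlives [t] exactly when [L t] is below its threshold, except on ties, which have
    probability 0 because the exponential law has no atoms. The infimum defining the system failure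
    time exceeds [t] exactly when the system works at [t], which rests on the monotonicity of the
    structure function. *)

Lemma powR_MVT (R : realType) (b x y : R) : 0 < y -> y <= x ->
  exists2 c : R, y <= c <= x & x `^ b - y `^ b = b * c `^ (b - 1) * (x - y).
Proof.
move=> y0 yx.
have der z : y <= z -> is_derive z 1 (fun x : R => x `^ b) (b * z `^ (b - 1)).
  by move=> yz; apply: is_derive1_powR; exact: lt_le_trans yz.
have [z||c] := @MVT_segment R (fun x : R => x `^ b) (fun z => b * z `^ (b - 1)) y x yx.
- by rewrite in_itv/= => /andP[/ltW + _]; exact: der.
- apply: derivable_within_continuous => z; rewrite in_itv/= => /andP[yz _].
  exact: (@ex_derive _ _ _ _ _ _ _ (der z yz)).
- by rewrite in_itv/= => ? ?; exists c.
Qed.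

Lemma ler0_powR (R : realType) (r x y : R) : r <= 0 -> 0 < x -> x <= y ->
  y `^ r <= x `^ r.
Proof.
move=> r0 x0 xy; have y0 := lt_le_trans x0 xy.
rewrite -[r]opprK !(powRN _ (- r)) lef_pV2 ?posrE ?powR_gt0//.
by rewrite ge0_ler_powR ?nnegrE ?oppr_ge0//; exact: ltW.
Qed.

(** A power is monotone on the positive axis, in a direction given by the sign of [r]; absolute
    values make both directions one statement. *)
Lemma powR_between (R : realType) (r x c y : R) : 0 < x -> x <= c <= y ->
  `|y `^ r - c `^ r| <= `|y `^ r - x `^ r|.
Proof.
move=> x0 /andP[xc cy].
have c0 := lt_le_trans x0 xc; have y0 := lt_le_trans c0 cy.
have [r0|/ltW r0] := leP 0 r.
- have h1 : x `^ r <= c `^ r by rewrite ge0_ler_powR ?nnegrE// ltW.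
  have h2 : c `^ r <= y `^ r by rewrite ge0_ler_powR ?nnegrE// ltW.
  by rewrite !ger0_norm ?subr_ge0//; [lra|exact: le_trans h2].
- have h1 := ler0_powR r0 x0 xc; have h2 := ler0_powR r0 c0 cy.
  rewrite distrC (distrC (y `^ r)) !ger0_norm ?subr_ge0//; first lra.
  exact: le_trans h1.
Qed.

(** Monotonicity gives equality in the triangle inequality, so variations over consecutive intervals
    telescope. *)
Lemma powR_monotone_split (R : realType) (r x c y : R) : 0 < x -> x <= c <= y ->
  `|y `^ r - c `^ r| + `|c `^ r - x `^ r| = `|y `^ r - x `^ r|.
Proof.
move=> x0 /andP[xc cy].
have c0 := lt_le_trans x0 xc; have y0 := lt_le_trans c0 cy.
have [r0|/ltW r0] := leP 0 r.
- have h1 : x `^ r <= c `^ r by rewrite ge0_ler_powR ?nnegrE// ltW.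
  have h2 : c `^ r <= y `^ r by rewrite ge0_ler_powR ?nnegrE// ltW.
  by rewrite !ger0_norm ?subr_ge0//; [lra|exact: le_trans h2].
- have h1 := ler0_powR r0 x0 xc; have h2 := ler0_powR r0 c0 cy.
  rewrite !(distrC (y `^ r)) (distrC (c `^ r) (x `^ r)) !ger0_norm ?subr_ge0//; first lra.
  exact: le_trans h1.
Qed.

Definition powsum (R : realType) (b : R) (j : nat) : R :=
  \sum_(1 <= i < j.+1) i%:R `^ (b - 1).

Lemma powsumS (R : realType) (b : R) (j : nat) :
  powsum b j.+1 = powsum b j + j.+1%:R `^ (b - 1).
Proof. by rewrite /powsum big_nat_recr. Qed.

Lemma powsum_le (R : realType) (b : R) (j n : nat) : (j <= n)%N ->
  powsum b j <= powsum b n.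
Proof.
elim: n => [|n IH]; first by rewrite leqn0 => /eqP ->.
rewrite leq_eqVlt => /predU1P[->//|]; rewrite ltnS => /IH jn.
by rewrite powsumS (le_trans jn)// lerDl powR_ge0.
Qed.

Lemma powsum_gt0 (R : realType) (b : R) (n : nat) : (0 < n)%N -> 0 < powsum b n.
Proof.
move=> n0; apply: lt_le_trans (powsum_le b n0).
by rewrite /powsum big_nat1 powR1.
Qed.

Lemma powsum_ge0 (R : realType) (b : R) (n : nat) : 0 <= powsum b n.
Proof. by rewrite /powsum sumr_ge0// => i _; rewrite powR_ge0. Qed.

(** Each new term replaces the mean value point [c] by the right endpoint, at a cost of at most [b]
    times the variation of the power over that unit interval. These variations add up to the last
    summand, and [b + 1] bounds the error at [j = 1]. *)
Lemma powsum_approx (R : realType) (b : R) (j : nat) : 0 < b -> (0 < j)%N ->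
  `|b * powsum b j - j%:R `^ b| <= b + 1 + b * `|j%:R `^ (b - 1) - 1|.
Proof.
move=> b0; elim: j => // -[_ _|j IH _].
  rewrite /powsum big_nat1 !powR1 mulr1 subrr normr0 mulr0 addr0.
  by apply: le_trans (ler_normB _ _) _; rewrite normr1 gtr0_norm.
have {IH} := IH isT; set u := j.+1%:R `^ (b - 1) => IH.
have j1 : j.+1%:R <= j.+2%:R :> R by rewrite ler_nat.
have [c /andP[c1 c2]] := @powR_MVT R b j.+2%:R j.+1%:R (ltr0Sn _ _) j1.
rewrite -[j.+2%:R - _]/(j.+2%:R - j.+1%:R) -natrB// subSnn mulr1 => mvt.
rewrite powsumS.
set v := j.+2%:R `^ (b - 1).
have vc : `|v - c `^ (b - 1)| <= `|v - u|.
  by apply: powR_between; rewrite ?c1 ?c2.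
have spl : `|v - u| + `|u - 1| = `|v - 1|.
  have := @powR_monotone_split R (b - 1) 1 j.+1%:R j.+2%:R ltr01.
  by rewrite powR1 j1 andbT; apply; rewrite -[1]/(1%:R) ler_nat.
have -> : b * (powsum b j.+1 + v) - j.+2%:R `^ b =
    (b * powsum b j.+1 - j.+1%:R `^ b) + b * (v - c `^ (b - 1)).
  have -> : j.+2%:R `^ b = j.+1%:R `^ b + b * c `^ (b - 1) by rewrite -mvt; ring.
  ring.
apply: le_trans (ler_normD _ _) _.
rewrite normrM (gtr0_norm b0) -spl mulrDr.
have := ler_wpM2l (ltW b0) vc.
lra.
Qed.

Definition powsum_error (R : realType) (b : R) (n : nat) : R :=
  (3 * b + 1) * n%:R `^ (- b) + b / n%:R.

Lemma powsum_approx_scaled (R : realType) (b : R) (j n : nat) : 0 < b -> (0 < n)%N ->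
  (j <= n)%N ->
  `|b * powsum b j / n%:R `^ b - (j%:R / n%:R) `^ b| <= powsum_error b n.
Proof.
move=> b0 n0 jn.
have nR0 : 0 < n%:R :> R by rewrite ltr0n.
have nb0 : 0 < n%:R `^ b :> R by rewrite powR_gt0.
have un0 : 0 <= n%:R `^ (b - 1) :> R by rewrite powR_ge0.
suff H : `|b * powsum b j - j%:R `^ b| <= (3 * b + 1) + b * n%:R `^ (b - 1).
  have -> : (j%:R / n%:R) `^ b = j%:R `^ b / n%:R `^ b :> R.
    rewrite powRM ?invr_ge0 ?ler0n//; congr (_ * _).
    by rewrite -[n%:R^-1]powR_inv1 ?ler0n// -powRrM mulN1r powRN.
  rewrite -mulrBl normrM (gtr0_norm (_ : 0 < _^-1)) ?invr_gt0//.
  rewrite ler_pdivrMr// /powsum_error powRN mulrDl.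
  rewrite mulfVK ?gt_eqF// -mulrA (mulrC n%:R^-1).
  suff -> : n%:R `^ b / n%:R = n%:R `^ (b - 1) :> R by [].
  by rewrite powRD ?powR_inv1 ?ler0n// (gt_eqF nR0) implybT.
case: j jn => [|j] jn.
  rewrite /powsum big_geq// mulr0 powR0 ?gt_eqF// subr0 normr0.
  by apply: addr_ge0; [lra|rewrite mulr_ge0// ltW].
apply: le_trans (powsum_approx b0 _) _ => //.
suff : `|j.+1%:R `^ (b - 1) - 1| <= 2 + n%:R `^ (b - 1).
  by move=> /(ler_wpM2l (ltW b0)); lra.
have j1 : 1 <= j.+1%:R :> R by rewrite -[1]/(1%:R) ler_nat.
have jn' : j.+1%:R <= n%:R :> R by rewrite ler_nat.
have := @powR_monotone_split R (b - 1) 1 j.+1%:R n%:R ltr01.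
rewrite powR1 j1 jn' => /(_ isT) spl.
rewrite (@le_trans _ _ `|n%:R `^ (b - 1) - 1|)//; first by rewrite -spl lerDr.
by apply: le_trans (ler_normB _ _) _; rewrite normr1 ger0_norm//; lra.
Qed.

Lemma powsum_ratio (R : realType) (b : R) (j n : nat) : 0 < b -> (0 < n)%N ->
  (j <= n)%N ->
  `|powsum b j / powsum b n - (j%:R / n%:R) `^ b| <= 2 * powsum_error b n.
Proof.
move=> b0 n0 jn.
have nR0 : 0 < n%:R :> R by rewrite ltr0n.
have nb0 : 0 < n%:R `^ b :> R by rewrite powR_gt0.
have Sn := powsum_gt0 b n0; have Sj := powsum_ge0 b j.
have h1 := powsum_approx_scaled b0 n0 jn.
have h2 := powsum_approx_scaled b0 n0 (leqnn n).
rewrite divff ?gt_eqF// powR1 in h2.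
set r := _ / powsum b n.
have r0 : 0 <= r by rewrite divr_ge0// ltW.
have r1 : r <= 1 by rewrite ler_pdivrMr// mul1r powsum_le.
(* The first summand is the error at [n] weighted by [r], which is at most 1, and the second is the
   error at [j]; hence the factor 2. *)
have -> : r - (j%:R / n%:R) `^ b = r * (1 - b * powsum b n / n%:R `^ b) +
    (b * powsum b j / n%:R `^ b - (j%:R / n%:R) `^ b).
  rewrite /r; field; rewrite !gt_eqF//.
apply: le_trans (ler_normD _ _) _; rewrite [leRHS]mulr_natl mulr2n lerD//.
rewrite normrM distrC (ger0_norm r0); apply: le_trans h2.
by rewrite ler_piMl.
Qed.

(** * Binomial means *)

Definition binomial_mean (R : realType) (n : nat) (p : R) (f : nat -> R) : R :=
  \sum_(j < n.+1) 'C(n, j)%:R * p ^+ j * (1 - p) ^+ (n - j) * f j.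

Lemma binomial_mean0 (R : realType) (p : R) f : binomial_mean 0 p f = f 0%N.
Proof. by rewrite /binomial_mean big_ord1 !expr0 !mul1r. Qed.

(** Pascal's rule, or conditioning on one trial; it gives the moments below by induction on [n]. *)
Lemma binomial_meanS (R : realType) n (p : R) f :
  binomial_mean n.+1 p f =
  p * binomial_mean n p (f \o succn) + (1 - p) * binomial_mean n p f.
Proof.
(* The extra term at [j = n.+1] vanishes with its binomial coefficient, and both sums then run over
   the same range. *)
have -> : (1 - p) * binomial_mean n p f =
    \sum_(j < n.+2) 'C(n, j)%:R * p ^+ j * (1 - p) ^+ (n.+1 - j) * f j.
  rewrite big_ord_recr/= bin_small// mulr0n !mul0r addr0 big_distrr/=.
  apply: eq_bigr => j _; rewrite (subSn (leq_ord j)) exprS.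
  by move: ('C(n, j)%:R : R) (p ^+ j) ((1 - p) ^+ (n - j)) => u v w; ring.
rewrite /binomial_mean big_distrr/= big_ord_recl [X in _ = _ + X]big_ord_recl/=.
rewrite !bin0 addrCA; congr (_ + _).
rewrite -big_split/=; apply: eq_bigr => j _.
rewrite /bump/= add1n binS natrD subSS exprS.
move: ('C(n, j)%:R : R) ('C(n, j.+1)%:R : R) (p ^+ j) ((1 - p) ^+ (n - j)).
by move=> u u' v w; ring.
Qed.

Lemma eq_binomial_mean (R : realType) n (p : R) f g : f =1 g ->
  binomial_mean n p f = binomial_mean n p g.
Proof. by move=> fg; apply: eq_bigr => j _; rewrite fg. Qed.

Lemma binomial_meanD (R : realType) n (p : R) f g :
  binomial_mean n p (f \+ g) = binomial_mean n p f + binomial_mean n p g.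
Proof.
by rewrite /binomial_mean -big_split; apply: eq_bigr => j _; rewrite /= mulrDr.
Qed.

Lemma binomial_meanZ (R : realType) n (p c : R) f :
  binomial_mean n p (fun j => c * f j) = c * binomial_mean n p f.
Proof. by rewrite /binomial_mean big_distrr; apply: eq_bigr => j _; rewrite mulrCA. Qed.

Lemma binomial_mean_cst (R : realType) n (p c : R) : binomial_mean n p (fun=> c) = c.
Proof.
elim: n => [|n IH]; first by rewrite binomial_mean0.
rewrite binomial_meanS (_ : _ \o _ = fun=> c)// IH; ring.
Qed.

Lemma binomial_mean_id (R : realType) n (p : R) :
  binomial_mean n p (fun j => j%:R) = n%:R * p.
Proof.
elim: n => [|n IH]; first by rewrite binomial_mean0 mul0r.
rewrite binomial_meanS (@eq_binomial_mean _ _ _ _ ((fun j => j%:R) \+ cst 1)).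
  rewrite binomial_meanD IH binomial_mean_cst -natr1; ring.
by move=> j /=; rewrite natr1.
Qed.

Lemma binomial_mean_sqr (R : realType) n (p : R) :
  binomial_mean n p (fun j => j%:R ^+ 2) = n%:R * p * (1 - p) + (n%:R * p) ^+ 2.
Proof.
elim: n => [|n IH].
  by rewrite binomial_mean0 !mul0r add0r.
rewrite binomial_meanS.
rewrite (@eq_binomial_mean _ _ _ _
  ((fun j => j%:R ^+ 2) \+ ((fun j => 2 * j%:R) \+ cst 1))).
  rewrite !binomial_meanD binomial_meanZ IH binomial_mean_id binomial_mean_cst.
  rewrite -natr1; ring.
by move=> j /=; rewrite -natr1; ring.
Qed.

Lemma binomial_mean_variance (R : realType) n (p : R) : (0 < n)%N ->
  binomial_mean n p (fun j => (j%:R / n%:R - p) ^+ 2) = p * (1 - p) / n%:R.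
Proof.
move=> n0; have nR0 : n%:R != 0 :> R by rewrite pnatr_eq0 -lt0n.
rewrite (@eq_binomial_mean _ _ _ _ ((fun j => n%:R ^- 2 * j%:R ^+ 2) \+
   ((fun j => (- 2 * p / n%:R) * j%:R) \+ cst (p ^+ 2)))).
  rewrite !binomial_meanD !binomial_meanZ binomial_mean_sqr binomial_mean_id.
  by rewrite binomial_mean_cst; field.
by move=> j /=; field.
Qed.

Lemma le_binomial_mean (R : realType) n (p : R) f g : 0 <= p <= 1 ->
  (forall j, (j <= n)%N -> f j <= g j) -> binomial_mean n p f <= binomial_mean n p g.
Proof.
move=> /andP[p0 p1] fg; apply: ler_sum => j _; apply: ler_wpM2l.
  by rewrite !mulr_ge0 ?exprn_ge0 ?subr_ge0.
by apply: fg; rewrite -ltnS.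
Qed.

(* Chebyshev: outside a [delta]-neighbourhood of [p] the hypothesis on [g] only
   costs a multiple of the variance. *)
Lemma binomial_mean_approx (R : realType) n (p c e K : R) f : (0 < n)%N ->
  0 <= K -> 0 <= p <= 1 ->
  (forall j, (j <= n)%N -> `|f j - c| <= e + K * (j%:R / n%:R - p) ^+ 2) ->
  `|binomial_mean n p f - c| <= e + K / n%:R.
Proof.
move=> n0 K0 p01 H; have /andP[p0 p1] := p01.
have nR0 : 0 < n%:R :> R by rewrite ltr0n.
have bound : binomial_mean n p (fun j => e + K * (j%:R / n%:R - p) ^+ 2) <= e + K / n%:R.
  rewrite (binomial_meanD n p (cst e)) binomial_mean_cst binomial_meanZ.
  rewrite binomial_mean_variance// lerD2l ler_wpM2l// ler_piMl ?invr_ge0 ?ler0n//.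
  by rewrite mulr_ile1 ?subr_ge0//; lra.
have -> : binomial_mean n p f - c = binomial_mean n p (fun j => f j - c).
  rewrite (binomial_meanD n p f (cst (- c))) binomial_mean_cst//.
rewrite ler_norml; apply/andP; split.
  rewrite lerNl -mulN1r -binomial_meanZ; apply: le_trans bound.
  apply: le_binomial_mean => // j jn; apply: le_trans (H j jn).
  by rewrite mulN1r lerNl lerNnormlW.
apply: le_trans bound; apply: le_binomial_mean => // j jn.
by apply: le_trans (H j jn); exact: ler_norm.
Qed.

(** * Modulus of continuity of real powers on the unit interval *)

(** Subadditivity of concave powers: [z / x] lies below its own [b]-th power when it is at most 1,
    and the fractions for [z = y] and [z = x - y] sum to 1. *)
Lemma powR_dist_le (R : realType) (b x y : R) : 0 < b ->
  0 <= y -> y <= x -> x <= 1 -> b <= 1 -> x `^ b - y `^ b <= (x - y) `^ b.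
Proof.
move=> b0 y0; rewrite le_eqVlt => /predU1P[-> _ _|yx x1 b1].
  by rewrite !subrr powR_ge0.
have x0 : 0 < x by exact: le_lt_trans yx.
have ratio z : 0 <= z <= x -> x `^ b * (z / x) <= z `^ b.
  move=> /andP[z0 zx].
  have [->|zneq] := eqVneq z 0; first by rewrite mul0r mulr0 powR_ge0.
  have zp : 0 < z by rewrite lt_neqAle eq_sym zneq.
  have zE : z `^ b = x `^ b * (z / x) `^ b.
    rewrite -powRM ?divr_ge0 ?(ltW x0)//; congr (_ `^ _).
    by rewrite mulrCA divff ?gt_eqF// mulr1.
  rewrite zE ler_wpM2l ?powR_ge0// ger1_powR//.
  by rewrite divr_gt0//= ler_pdivrMr// mul1r.
have h1 := ratio y; have h2 := ratio (x - y).
rewrite y0 (ltW yx) in h1; rewrite subr_ge0 (ltW yx) lerBlDr lerDl y0 in h2.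
have := lerD (h1 isT) (h2 isT).
have -> : x `^ b * (y / x) + x `^ b * ((x - y) / x) = x `^ b.
  by field; rewrite gt_eqF.
lra.
Qed.

Lemma powR_lipschitz (R : realType) (b x y : R) :
  1 <= b -> 0 <= y -> y <= x -> x <= 1 -> x `^ b - y `^ b <= b * (x - y).
Proof.
move=> b1; rewrite le_eqVlt => /predU1P[<- x0 x1|y0 yx x1].
  rewrite powR0 ?gt_eqF//; last by lra.
  have [<-|xneq] := eqVneq 0 x; first by rewrite powR0 ?gt_eqF//; lra.
  have xp : 0 < x by rewrite lt_neqAle xneq.
  have := @ge1r_powR _ x b _ b1; rewrite xp x1 => /(_ isT).
  have : 0 <= (b - 1) * x by rewrite mulr_ge0// subr_ge0.
  lra.
have [c /andP[yc cx] ->] := @powR_MVT R b x y y0 yx.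
rewrite ler_wpM2r ?subr_ge0// ler_piMr//; first lra.
rewrite -[leRHS](_ : 1 `^ (b - 1) = 1); last by rewrite powR1.
rewrite ge0_ler_powR ?nnegrE//; lra.
Qed.

Lemma powR_modulus (R : realType) (b e : R) : 0 < b -> 0 < e ->
  exists2 delta : R, 0 < delta &
    forall x y, 0 <= x <= 1 -> 0 <= y <= 1 -> `|x - y| <= delta ->
      `|x `^ b - y `^ b| <= e.
Proof.
move=> b0 e0.
suff [d d0 H] : exists2 delta : R, 0 < delta &
    forall x y, 0 <= y -> y <= x -> x <= 1 -> x - y <= delta ->
      x `^ b - y `^ b <= e.
  exists d => // x y /andP[x0 x1] /andP[y0 y1].
  have [yx|/ltW xy] := leP y x.
    rewrite !ger0_norm ?subr_ge0//; first exact: H.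
    by rewrite ge0_ler_powR ?nnegrE// ltW.
  rewrite distrC (distrC (x `^ b)) !ger0_norm ?subr_ge0//; first exact: H.
  by rewrite ge0_ler_powR ?nnegrE// ltW.
have [b1|/ltW b1] := leP b 1.
  exists (e `^ b^-1); first exact: powR_gt0.
  move=> x y y0 yx x1 xye; apply: le_trans (powR_dist_le b0 y0 yx x1 b1) _.
  rewrite (_ : e = (e `^ b^-1) `^ b); last first.
    by rewrite -powRrM mulVf ?gt_eqF// powRr1// ltW.
  rewrite ge0_ler_powR ?nnegrE ?powR_ge0 ?subr_ge0//; exact: ltW.
exists (e / b); first exact: divr_gt0.
move=> x y y0 yx x1 xye; apply: le_trans (powR_lipschitz b1 y0 yx x1) _.
by rewrite mulrC -ler_pdivlMr.
Qed.

(** With [K = d ^- 2] the quadratic term exceeds 1, hence the whole oscillation, as soon as the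
    points are more than [d] apart. In this form the modulus can be averaged directly, the square
    becoming a variance. *)
Lemma powR_quadratic_modulus (R : realType) (b e : R) : 0 < b -> 0 < e ->
  exists2 K : R, 0 <= K &
    forall x y, 0 <= x <= 1 -> 0 <= y <= 1 ->
      `|x `^ b - y `^ b| <= e + K * (x - y) ^+ 2.
Proof.
move=> b0 e0; have [d d0 H] := powR_modulus b0 e0.
have b0' := ltW b0.
exists (d ^- 2); first by rewrite invr_ge0 sqr_ge0.
move=> x y x01 y01; have [xyd|/ltW dxy] := leP `|x - y| d.
  apply: le_trans (H x y x01 y01 xyd) _.
  by rewrite lerDl mulr_ge0 ?sqr_ge0// invr_ge0 sqr_ge0.
have bd z : 0 <= z <= 1 -> 0 <= z `^ b <= 1.
  move=> /andP[z0 z1]; rewrite powR_ge0/=.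
  rewrite -[leRHS](_ : 1 `^ b = 1); last by rewrite powR1.
  by rewrite ge0_ler_powR ?nnegrE.
have K1 : 1 <= d ^- 2 * (x - y) ^+ 2.
  rewrite mulrC ler_pdivlMr ?exprn_gt0// mul1r -(real_normK (num_real (x - y))).
  by rewrite lerXn2r ?nnegrE// ltW.
have /andP[? ?] := bd _ x01; have /andP[? ?] := bd _ y01.
rewrite ler_norml; apply/andP; split; lra.
Qed.

(** * Uniform limit of the Bernstein polynomials *)

Lemma powsum_error_near (R : realType) (b e : R) : 0 < b -> 0 < e ->
  \forall n \near \oo, powsum_error b n <= e.
Proof.
move=> b0 e0.
pose D := 3 * b + 1.
have D0 : 0 < D by rewrite /D; lra.
(* Each entry is the threshold from which one of the two terms of [powsum_error] is at most
   [e / 2]. *)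
pose A := Num.max (((e / 2) / D) `^ (- b^-1)) (b / (e / 2)).
near=> n.
have An : A <= n%:R by near: n; exact: nbhs_infty_ger.
have n0 : (0 < n)%N by near: n; exact: nbhs_infty_gt.
have nR0 : 0 < n%:R :> R by rewrite ltr0n.
rewrite /powsum_error -/D (splitr e) lerD//.
- rewrite mulrC -ler_pdivlMr//.
  have q0 : 0 < e / 2 / D by rewrite !divr_gt0.
  apply: le_trans (@ler0_powR _ (- b) (((e / 2) / D) `^ (- b^-1)) _ _ _ _) _.
  + by rewrite oppr_le0 ltW.
  + exact: powR_gt0.
  + by apply: le_trans An; rewrite le_max lexx.
  + by rewrite -powRrM mulrNN mulVf ?gt_eqF// powRr1// ltW.
- rewrite ler_pdivrMr// mulrC -ler_pdivrMr ?divr_gt0//.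
  by apply: le_trans An; rewrite le_max lexx orbT.
Unshelve. all: by end_near. Qed.

Lemma binomial_mean_powsum (R : realType) (b e : R) : 0 < b -> 0 < e ->
  \forall n \near \oo, forall p : R, 0 <= p <= 1 ->
    `|binomial_mean n p (fun j => powsum b j / powsum b n) - p `^ b| <= e.
Proof.
move=> b0 e0.
have e3 : 0 < e / 3 by rewrite divr_gt0.
have [K K0 HK] := powR_quadratic_modulus b0 e3.
near=> n => p p01.
have n0 : (0 < n)%N by near: n; exact: nbhs_infty_gt.
have nR0 : 0 < n%:R :> R by rewrite ltr0n.
have En : powsum_error b n <= e / 3 / 2.
  by near: n; apply: powsum_error_near => //; rewrite divr_gt0.
have Kn : K / n%:R <= e / 3.
  rewrite ler_pdivrMr// mulrC -ler_pdivrMr//.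
  by near: n; exact: nbhs_infty_ger.
(* The three shares pay for the power sum ratio (twice an error of [e / 6]), the modulus of the
   power, and the variance term [K / n%:R]. *)
have -> : e = (e / 3 + e / 3) + e / 3 by field.
apply: le_trans (@binomial_mean_approx _ n p _ (e / 3 + e / 3) K _ n0 K0 p01 _) _.
  move=> j jn.
  have jn01 : 0 <= (j%:R / n%:R : R) <= 1.
    by rewrite divr_ge0//= ler_pdivrMr// mul1r ler_nat.
  have h1 := powsum_ratio b0 n0 jn; have h2 := HK (j%:R / n%:R) p jn01 p01.
  rewrite -[X in `|X|](subrKA ((j%:R / n%:R) `^ b)).
  apply: le_trans (ler_normD _ _) _; lra.
by rewrite lerD2l.
Unshelve. all: by end_near. Qed.

(** * Independent pairs and Laplace transforms *)

Section IndependentPair.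
Context d (O : measurableType d) (R : realType) (P : probability O R).
Context d1 (E1 : measurableType d1) d2 (E2 : measurableType d2).
Variables (X : {RV P >-> E1}) (Y : {RV P >-> E2}).
Hypothesis XY : forall A B, measurable A -> measurable B ->
  P (X @^-1` A `&` Y @^-1` B) = (P (X @^-1` A) * P (Y @^-1` B))%E.

Let XYpair : {RV P >-> (E1 * E2)%type} :=
  mfun_Sub (mem_set (measurable_fun_pair (measurable_funPT X) (measurable_funPT Y))).

Let independent_pair_law (D : set (E1 * E2)) : measurable D ->
  (distribution P X \x distribution P Y)%E D = distribution P XYpair D.
Proof.
move=> mD.
by apply: (product_measure_unique (m' := distribution P XYpair)).
Qed.

(** Fubini for the product law: freeze [X] and average over [Y]. This replaces conditioning on the
    subordinator, with [L t] as [X] and the thresholds as [Y]. *)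
Lemma independent_pair_section (D : set (E1 * E2)) : measurable D ->
  P [set w | D (X w, Y w)] =
  (\int[P]_w P [set w' | D (X w, Y w')])%E.
Proof.
move=> mD.
have <- : distribution P XYpair D = P [set w | D (X w, Y w)] by [].
rewrite -independent_pair_law// /product_measure1 ge0_integral_distribution//.
  apply: eq_integral => w _ /=; congr (P _).
  by apply/seteqP; split => w' /=; rewrite xsectionP.
exact: measurable_fun_xsection.
Qed.

Lemma independent_pair_integral (f : E1 -> R) (g : E2 -> R) :
  measurable_fun setT f -> measurable_fun setT g ->
  (forall x, 0 <= f x) -> (forall y, 0 <= g y) ->
  (\int[P]_w (f (X w) * g (Y w))%:E =
   (\int[P]_w (f (X w))%:E) * (\int[P]_w (g (Y w))%:E))%E.
Proof.
move=> mf mg f0 g0.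
pose h (z : E1 * E2) : \bar R := (f z.1 * g z.2)%:E.
have mh : measurable_fun setT h.
  apply/measurable_EFinP; apply: measurable_funM.
    exact: measurableT_comp.
  exact: measurableT_comp.
have h0 z : (0 <= h z)%E by rewrite lee_fin mulr_ge0.
have mf' : measurable_fun setT (EFin \o f) by apply/measurable_EFinP.
have mg' : measurable_fun setT (EFin \o g) by apply/measurable_EFinP.
transitivity (\int[distribution P XYpair]_z h z)%E.
  by rewrite ge0_integral_distribution.
rewrite -(eq_measure_integral (distribution P XYpair)
  (m1 := (distribution P X \x distribution P Y)%E)); last first.
  by move=> A mA _; exact: independent_pair_law.
rewrite fubini_tonelli1//.
have -> : (\int[P]_w (f (X w))%:E = \int[distribution P X]_x (f x)%:E)%E.
  by rewrite ge0_integral_distribution// => x; rewrite lee_fin.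
have -> : (\int[P]_w (g (Y w))%:E = \int[distribution P Y]_y (g y)%:E)%E.
  by rewrite ge0_integral_distribution// => y; rewrite lee_fin.
rewrite -ge0_integralZr//; last 2 first.
- by move=> x _; rewrite lee_fin.
- by apply: integral_ge0 => y _; rewrite lee_fin.
apply: eq_integral => x _; rewrite -ge0_integralZl//; last 2 first.
- by move=> y _; rewrite lee_fin.
- by rewrite lee_fin.
Qed.

End IndependentPair.

(** * Cauchy's equation and the Laplace transform of a subordinator *)

Lemma additive_nondecreasing_linear (R : realType) (H : R -> R) :
  (forall s t, 0 <= s -> 0 <= t -> H (s + t) = H s + H t) ->
  (forall s t, 0 <= s -> s <= t -> H s <= H t) ->
  forall t, 0 <= t -> H t = t * H 1.
Proof.
move=> HD Hmono t t0.
have H0 : H 0 = 0 by have := HD 0 0 (lexx _) (lexx _); rewrite addr0; lra.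
have Hn n s : 0 <= s -> H (n%:R * s) = n%:R * H s.
  move=> s0; elim: n => [|n IH]; first by rewrite !mul0r.
  by rewrite -natr1 !mulrDl !mul1r HD ?mulr_ge0// IH.
have H1 : 0 <= H 1 by rewrite -H0 Hmono.
(* With [k] the integer part of [m.+1%:R * t], both products lie between [k%:R * H 1] and
   [k.+1%:R * H 1]. *)
have bound m : `|m.+1%:R * (H t - t * H 1)| <= H 1.
  have mt0 : 0 <= m.+1%:R * t by rewrite mulr_ge0.
  have /andP[] := truncn_itv mt0; set k := Num.truncn _ => kmt mtk.
  have lb : k%:R * H 1 <= m.+1%:R * H t.
    by rewrite -!Hn// mulr1 Hmono.
  have ub : m.+1%:R * H t <= k.+1%:R * H 1.
    by rewrite -!Hn// mulr1 Hmono// ltW.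
  have lb' : k%:R * H 1 <= m.+1%:R * t * H 1 by rewrite ler_wpM2r.
  have ub' : m.+1%:R * t * H 1 <= k.+1%:R * H 1 by rewrite ler_wpM2r// ltW.
  rewrite -natr1 mulrDl mul1r in ub ub'.
  by rewrite ler_norml mulrBr mulrA; apply/andP; split; lra.
apply/eqP; rewrite -subr_eq0 -normr_eq0; apply/negPn/negP => neq0.
have a0 : 0 < `|H t - t * H 1| by rewrite lt_neqAle eq_sym neq0 normr_ge0.
(* This [m] makes the multiple of a nonzero difference exceed [H 1]. *)
have := bound (Num.truncn (H 1 / `|H t - t * H 1|)).
rewrite normrM normr_nat -ler_pdivlMr// leNgt.
by rewrite truncnS_gt.
Qed.

Section LaplaceTransform.
Context d (O : measurableType d) (R : realType) (P : probability O R).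
Variables (L : R -> {RV P >-> R}) (hL : levy_subordinator L) (b : R).
Hypothesis b0 : 0 < b.

Let phi (x : R) : R := expR (- b * x).

Let measurable_phi : measurable_fun setT phi.
Proof. by apply: measurableT_comp => //; exact: mulrl_measurable. Qed.

Definition laplace_transform (t : R) : \bar R := (\int[P]_w (phi (L t w))%:E)%E.

Lemma subordinator_ge0 w t : 0 <= t -> 0 <= L t w.
Proof.
move=> t0; rewrite -(subordinator_start hL w).
exact: (subordinator_nondecreasing hL).
Qed.

Let phi_le1 w t : 0 <= t -> phi (L t w) <= 1.
Proof.
move=> t0; rewrite /phi -expR0 ler_expR mulNr oppr_le0 mulr_ge0//; first exact: ltW.
exact: subordinator_ge0.
Qed.

Let measurable_phiL t : measurable_fun setT (fun w => (phi (L t w))%:E).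
Proof. by apply/measurable_EFinP; apply: measurableT_comp. Qed.

(** A strictly positive integrand with zero integral would make the whole space null. Positivity
    lets the logarithm turn products into sums. *)
Lemma laplace_transform_gt0 t : (0 < laplace_transform t)%E.
Proof.
rewrite lt_neqAle integral_ge0 ?andbT; last by move=> w _; rewrite lee_fin expR_ge0.
apply/negP => /eqP/esym I0.
have := ae_eq_integral_abs P (@measurableT _ O) (measurable_phiL t).
case=> + _; rewrite (eq_integral (fun w => (phi (L t w))%:E)); last first.
  by move=> w _; rewrite gee0_abs// lee_fin expR_ge0.
move=> /(_ I0) [N [mN N0 sub]].
have NT : N = setT.
  apply/seteqP; split => // w _; apply: sub => /(_ I) /=.
  by case=> /eqP; rewrite expR_eq0.
have := probability_setT P; rewrite -NT N0 => /eqP.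
by rewrite eqe eq_sym oner_eq0.
Qed.

Lemma laplace_transform_le1 t : 0 <= t -> (laplace_transform t <= 1)%E.
Proof.
move=> t0; rewrite -(probability_setT P) -[leRHS]mul1e -(integral_cst P)//.
apply: ge0_le_integral => //.
- by move=> w _; rewrite lee_fin expR_ge0.
- by move=> w _; rewrite lee_fin phi_le1.
Qed.

Lemma laplace_transform_nonincreasing s t : 0 <= s -> s <= t ->
  (laplace_transform t <= laplace_transform s)%E.
Proof.
move=> s0 st; apply: ge0_le_integral => //.
- by move=> w _; rewrite lee_fin expR_ge0.
- move=> w _; rewrite lee_fin /phi ler_expR !mulNr lerN2 ler_wpM2l//; first exact: ltW.
  exact: (subordinator_nondecreasing hL).
Qed.

Lemma laplace_transformD s h : 0 <= s -> 0 <= h ->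
  (laplace_transform (s + h) = laplace_transform s * laplace_transform h)%E.
Proof.
move=> s0 h0.
pose Y : {RV P >-> R} := L (s + h) \- L s.
have L0 := subordinator_start hL.
have indep A B : measurable A -> measurable B ->
    P (L s @^-1` A `&` Y @^-1` B) = (P (L s @^-1` A) * P (Y @^-1` B))%E.
  move=> mA mB.
  (* At the times 0, [s], [s + h] the two increments are [L s], since the process starts at 0, and
     [Y]. *)
  pose t (n : nat) : R := if n is n'.+1 then if n' is _.+1 then s + h else s else 0.
  have tmono i j : (i <= j)%N -> t i <= t j.
    by case: i j => [|[|i]] [|[|j]]//= _; rewrite ?addr_ge0// lerDl.
  have := @subordinator_independent _ _ _ _ _ hL 2 t (lexx 0) tmono
    (fun i : 'I_2 => if (i : nat) == 0%N then A else B).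
  rewrite big_ord_recl big_ord1/=.
  have -> : (fun w => L s w - L 0 w) = L s by apply/funext => w; rewrite L0 subr0.
  move=> E; rewrite -[RHS]E; last by move=> i; case: ifP.
  congr (P _); apply/seteqP; split => w /=.
    by move=> [Aw Bw] [[|[|i]]// i2] /=; rewrite L0 subr0.
  move=> H; split; last exact: (H (lift ord0 ord0)).
  by have := H ord0; rewrite /= L0 subr0.
have lawY : (\int[P]_w (phi (Y w))%:E = laplace_transform h)%E.
  have ge0 (z : R) : (0 <= (phi z)%:E)%E by rewrite lee_fin expR_ge0.
  have mphi : measurable_fun setT (EFin \o phi) by apply/measurable_EFinP.
  rewrite -[LHS](ge0_integral_distribution Y mphi ge0).
  rewrite -[RHS](ge0_integral_distribution (L h) mphi ge0).
  apply: eq_measure_integral => A mA _.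
  transitivity (P [set w | A (L (s + h) w - L s w)]) => //.
  rewrite (subordinator_stationary hL s0 h0 mA).
  by congr (P _); apply/funext => w/=; rewrite L0 subr0.
rewrite -lawY -(independent_pair_integral indep)//; last 2 first.
- by move=> x; exact: expR_ge0.
- by move=> x; exact: expR_ge0.
by apply: eq_integral => w _; rewrite /phi -expRD; congr (expR _)%:E; rewrite /=; ring.
Qed.

Lemma laplace_transformE t : 0 <= t ->
  laplace_transform t = (expR (- laplace_exponent L b * t))%:E.
Proof.
move=> t0.
have fin s : 0 <= s -> laplace_transform s \is a fin_num.
  move=> s0; rewrite ge0_fin_numE ?(ltW (laplace_transform_gt0 s))//.
  exact: le_lt_trans (laplace_transform_le1 s0) (ltry _).
have pos s : 0 <= s -> 0 < fine (laplace_transform s).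
  move=> s0; rewrite fine_gt0// laplace_transform_gt0 -ge0_fin_numE ?fin//.
  by rewrite ltW// laplace_transform_gt0.
(* Additive by independence and stationarity, nondecreasing because the paths are, hence linear with
   slope [H 1], the Laplace exponent. *)
pose H s := - ln (fine (laplace_transform s)).
have HD s h : 0 <= s -> 0 <= h -> H (s + h) = H s + H h.
  move=> s0 h0; rewrite /H laplace_transformD// fineM ?fin// lnM ?posrE ?pos//.
  by rewrite opprD.
have Hmono s h : 0 <= s -> s <= h -> H s <= H h.
  move=> s0 sh; have h0 := le_trans s0 sh.
  rewrite /H lerN2 ler_ln ?posrE ?pos// fine_le ?fin//.
  exact: laplace_transform_nonincreasing.
have psiE : laplace_exponent L b = H 1.
  by rewrite /laplace_exponent/H unlock.
rewrite -[LHS]fineK ?fin//; congr (_%:E).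
rewrite psiE -[LHS]lnK ?posrE ?pos//; congr expR.
have := additive_nondecreasing_linear HD Hmono t0.
by rewrite mulNr mulrC => <-; rewrite /H opprK.
Qed.

End LaplaceTransform.

(** * Levy-frailty failure times *)

Lemma measurable_forall_fin d (T : measurableType d) (I : finType) (A : I -> set T) :
  (forall i, measurable (A i)) -> measurable [set w | forall i, A i w].
Proof.
move=> mA; rewrite (_ : [set _ | _] = \bigcap_(i in [set: I]) A i).
  by apply: fin_bigcap_measurable => //; exact: finite_finset.
by apply/seteqP; split => [w H i _|w H i]; exact: H.
Qed.

Lemma measurable_ltr_eq d (T : measurableType d) (R : realType) (f g : T -> R) (c : bool) :
  measurable_fun setT f -> measurable_fun setT g ->
  measurable [set w | (f w < g w) = c].
Proof.
move=> mf mg.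
have := measurable_fun_ltr mf mg measurableT (Y := [set c]) I.
by rewrite setTI.
Qed.

Lemma probability_eq_off_null d (T : measurableType d) (R : realType)
    (P : probability T R) (A B N : set T) :
  measurable A -> measurable B -> measurable N -> P N = 0%E ->
  A `\` N = B `\` N -> P A = P B.
Proof.
move=> mA mB mN N0 AB.
rewrite (measureDI P mA mN) (measureDI P mB mN) AB; congr (_ + _)%E.
rewrite !(@subset_measure0 _ _ _ P (_ `&` N) N)//; exact: measurableI.
Qed.

Lemma exponential_prob_tail (R : realType) (r m : R) : 0 < r -> 0 <= m ->
  exponential_prob r `]m, +oo[ = (expR (- r * m))%:E.
Proof.
move=> r0 m0; rewrite /exponential_prob.
have mE D : measurable_fun D (fun x => (exponential_pdf r x)%:E).
  by apply/measurable_funTS/measurable_EFinP; exact: measurable_exponential_pdf.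
have cE : continuous (fun z : R => expR (- r * z)).
  by move=> z; apply: continuous_comp; [exact: mulrl_continuous|exact: continuous_expR].
rewrite integral_itv_obnd_cbnd//.
rewrite (@ge0_continuous_FTC2y _ _ (fun x => - expR (- r * x)) _ 0)//.
- by rewrite EFinN oppeK add0e.
- by move=> x _; apply: exponential_pdf_ge0; exact: ltW.
- apply: (@continuous_subspaceW R^o _ _ [set` `[0, +oo[%R]).
    by apply: subset_itvr; rewrite bnd_simp.
  exact: within_continuous_exponential_pdf.
- rewrite -oppr0; apply: cvgN.
  rewrite (_ : (fun x => expR (- r * x)) =
      (fun z => expR (- z)) \o (fun z => r * z)); last first.
    by apply/funext => x /=; rewrite mulNr.
  apply: (@cvg_comp _ _ _ _ _ _ (pinfty_nbhs R)); last exact: cvgr_expR.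
  exact: gt0_cvgMry.
- by apply: cvgN; apply/cvg_at_right_filter; exact: cE.
- move=> z; rewrite in_itv/= andbT => mz.
  by apply: derive1_exponential_pdf; rewrite in_itv/= andbT (le_lt_trans m0).
Qed.

Lemma sigma_generated_process d (T : measurableType d) d' (E : measurableType d')
    (I : Type) (D : set I) (X : I -> T -> E) i A : D i -> measurable A ->
  sigma_generated D X (X i @^-1` A).
Proof.
move=> Di mA; apply: sub_sigma_algebra; exists i => //.
by exists A => //; rewrite setTI.
Qed.

Lemma sigma_generated_joint d (T : measurableType d) d' (E : measurableType d')
    n (X : 'I_n -> T -> E) (A : set (n.-tuple E)) : measurable A ->
  sigma_generated setT X (joint X @^-1` A).
Proof.
move=> mA.
pose G := \bigcup_(i in [set: 'I_n]) preimage_set_system setT (X i) measurable.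
have mX : measurable_fun setT (joint X : g_sigma_algebraType G -> n.-tuple E).
  apply/measurable_fun_tnthP => i.
  rewrite (_ : _ \o _ = X i); last by apply/funext => w; rewrite /= tnth_mktuple.
  by move=> _ B mB; rewrite setTI; exact: sigma_generated_process.
by have := mX measurableT A mA; rewrite setTI.
Qed.

Section LFMOTimes.
Context (R : realType) d (O : measurableType d) (P : probability O R) (n : nat).
Variables (L : R -> {RV P >-> R}) (eps : 'I_n -> {RV P >-> R}).
Hypothesis hL : levy_subordinator L.
Hypothesis heps : forall i A, measurable A ->
  distribution P (eps i) A = exponential_prob 1 A.
Hypothesis ieps : mutually_independent P (fun i => eps i : O -> R).
Hypothesis iLeps : forall A B : set O,
  sigma_generated [set t : R | 0 <= t] (fun t => L t : O -> R) A ->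
  sigma_generated setT (fun i => eps i : O -> R) B ->
  P (A `&` B) = (P A * P B)%E.
Variables (t : R) (t0 : 0 <= t).

Local Notation time i := (lfmo_time (fun s => L s : O -> R) (eps i)).

(** Because paths are nondecreasing, not having crossed the threshold at some point after [t] is
    what keeps the infimum above [t]. The points [t + k.+1%:R^-1] suffice, so the event is a
    countable union of measurable sets. *)
Lemma lfmo_time_gtP i w :
  (t%:E < time i w)%E <-> exists k, L (t + k.+1%:R^-1) w <= eps i w.
Proof.
split=> [tT|[k Lk]].
  apply/not_existsP => H; move: tT; apply/negP; rewrite -leNgt.
  apply/lee_addgt0Pr => e e0.
  pose k := Num.truncn e^-1.
  have ke : k.+1%:R^-1 <= e.
    by rewrite invf_ple ?posrE// ltW// truncnS_gt.
  apply: ge_ereal_inf; exists (t + k.+1%:R^-1)%:E; last by rewrite -EFinD lee_fin lerD2l.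
  exists (t + k.+1%:R^-1) => //=; split; first by rewrite addr_ge0 ?invr_ge0.
  by rewrite ltNge; apply/negP; exact: H.
apply: (@lt_le_trans _ _ (t + k.+1%:R^-1)%:E).
  by rewrite lte_fin ltrDl invr_gt0.
apply: le_ereal_inf_tmp => _ [u /= [u0 epsu] <-]; rewrite lee_fin leNgt.
apply/negP => uk; have := lt_le_trans epsu (subordinator_nondecreasing hL w u0 (ltW uk)).
by rewrite ltNge Lk.
Qed.

Lemma measurable_lfmo_gt i (c : bool) :
  measurable [set w | (t%:E < time i w)%E = c].
Proof.
have mT : measurable [set w | (t%:E < time i w)%E].
  rewrite (_ : [set _ | _] = \bigcup_k [set w | (eps i w < L (t + k.+1%:R^-1) w) = false]).
    by apply: bigcupT_measurable => k; exact: measurable_ltr_eq.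
  apply/seteqP; split => w /=.
    by move=> /lfmo_time_gtP[k Lk]; exists k => //=; apply/negbTE; rewrite -leNgt.
  by move=> [k _ /= /negbT]; rewrite -leNgt => Lk; apply/lfmo_time_gtP; exists k.
case: c; first by [].
rewrite (_ : [set _ | _] = ~` [set w | (t%:E < time i w)%E]); first exact: measurableC.
by apply/seteqP; split => w /=; [move=> -> | move/negP/negbTE].
Qed.

(** On a tie the path may stay flat after [t], so the crossing time can exceed [t] without
    [L t w < eps i w]. Off ties, right continuity keeps the path below the threshold shortly after
    [t]. *)
Lemma lfmo_time_gt_threshold i w : eps i w != L t w ->
  (t%:E < time i w)%E = (L t w < eps i w).
Proof.
move=> neq; apply/idP/idP.
  move=> /lfmo_time_gtP[k Lk]; rewrite lt_neqAle eq_sym neq/=; apply: le_trans Lk.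
  by apply: (subordinator_nondecreasing hL) => //; rewrite lerDl invr_ge0.
move=> Lt; apply/lfmo_time_gtP.
have /cvgr_lt/(_ _ Lt) := @subordinator_right_continuous _ _ _ _ _ hL w t t0.
move=> [e /= e0 He].
pose k := Num.truncn e^-1.
have ke : k.+1%:R^-1 < e.
  by rewrite invf_plt ?posrE// truncnS_gt.
exists k; apply/ltW/He => /=; last by rewrite ltrDl invr_gt0.
by rewrite opprD addrA subrr sub0r normrN gtr0_norm ?invr_gt0.
Qed.

Let measurable_joint : measurable_fun setT (joint (fun i => eps i : O -> R)).
Proof.
apply/measurable_fun_tnthP => i.
by rewrite (_ : _ \o _ = eps i)//; apply/funext => w; rewrite /= tnth_mktuple.
Qed.

Let Eps : {RV P >-> n.-tuple R} := mfun_Sub (mem_set measurable_joint).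

Let independent_threshold i : forall A B, measurable A -> measurable B ->
  P (L t @^-1` A `&` eps i @^-1` B) = (P (L t @^-1` A) * P (eps i @^-1` B))%E.
Proof.
move=> A B mA mB; apply: iLeps.
  exact: (@sigma_generated_process _ _ _ _ _ _ (fun t => L t : O -> R)).
exact: (@sigma_generated_process _ _ _ _ _ _ (fun i => eps i : O -> R)).
Qed.

Let independent_joint : forall A B, measurable A -> measurable B ->
  P (L t @^-1` A `&` Eps @^-1` B) = (P (L t @^-1` A) * P (Eps @^-1` B))%E.
Proof.
move=> A B mA mB; apply: iLeps.
  exact: (@sigma_generated_process _ _ _ _ _ _ (fun t => L t : O -> R)).
exact: sigma_generated_joint.
Qed.

(** For a frozen value of [L t] the tie is a single point, to which the exponential law gives no
    mass. *)
Lemma threshold_null i : P [set w | eps i w = L t w] = 0%E.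
Proof.
have mD : measurable [set z : R * R | z.2 = z.1].
  have := @measurable_fun_eqr _ _ R setT _ _ (@measurable_snd _ _ R R) measurable_fst
    measurableT [set true] I.
  rewrite setTI => H; rewrite (_ : [set _ | _] =
    (fun x : R * R => x.2 == x.1) @^-1` [set true])//.
  by apply/seteqP; split => z /= /eqP.
rewrite (independent_pair_section (independent_threshold i) mD).
apply: integral0_eq => w _ /=.
transitivity (distribution P (eps i) [set L t w]) => //.
by rewrite heps// /exponential_prob integral_set1.
Qed.

Let measurable_threshold i : measurable [set w | eps i w = L t w].
Proof.
have := @measurable_fun_eqr _ _ R setT _ _ (measurable_funPT (eps i))
  (measurable_funPT (L t)) measurableT [set true] I.
rewrite setTI => H; rewrite (_ : [set _ | _] =
  (fun w => eps i w == L t w) @^-1` [set true])//.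
by apply/seteqP; split => z /= /eqP.
Qed.

Let threshold_prob i (x : bool) m : 0 <= m ->
  P (eps i @^-1` [set e | (m < e) = x]) = (if x then expR (- m) else 1 - expR (- m))%:E.
Proof.
move=> m0.
have H : P (eps i @^-1` `]m, +oo[) = (expR (- m))%:E.
  by rewrite -[LHS]/(distribution P (eps i) _) heps// exponential_prob_tail// mulN1r.
case: x => /=.
  rewrite -H; congr (P _); apply/seteqP; split => w /=; by rewrite in_itv/= andbT.
have mE : measurable (eps i @^-1` `]m, +oo[).
  by rewrite -[X in measurable X]setTI; exact: measurable_funPT.
rewrite EFinB -H -(probability_setC P mE); congr (P _).
by apply/seteqP; split => w /=; rewrite in_itv/= andbT; [move=> -> | move/negP/negbTE].
Qed.

Lemma lfmo_state_prob (x : 'I_n -> bool) :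
  P [set w | forall i, (t%:E < time i w)%E = x i] =
  (\int[P]_w (\prod_i (if x i then expR (- L t w) else 1 - expR (- L t w)))%:E)%E.
Proof.
(* The two events agree off the finite union of the null tie events. *)
transitivity (P [set w | forall i, (L t w < eps i w) = x i]).
  apply: (@probability_eq_off_null _ _ _ _ _ _
    (\big[setU/set0]_(i < n) [set w | eps i w = L t w])).
  - by apply: measurable_forall_fin => i; exact: measurable_lfmo_gt.
  - by apply: measurable_forall_fin => i; exact: measurable_ltr_eq.
  - by apply: bigsetU_measurable => i _; exact: measurable_threshold.
  - apply: measure_negligible.
      by apply: bigsetU_measurable => i _; exact: measurable_threshold.
    elim/big_ind: _ => [|A B|i _]; [exact: negligible_set0|exact: negligibleU|].
    by apply/negligibleP; [exact: measurable_threshold|exact: threshold_null].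
  - apply/seteqP; split => w /= [H Nw]; split => // i; rewrite -H;
      (rewrite lfmo_time_gt_threshold//; apply/eqP => E; apply: Nw;
       by rewrite -bigcup_seq; exists i => //=; rewrite mem_index_enum).
(* The event depends on [L t] and the vector of thresholds. Once [L t] is frozen, mutual
   independence of the thresholds yields the product. *)
pose D : set (R * n.-tuple R) := [set z | forall i, (z.1 < tnth z.2 i) = x i].
have mD : measurable D.
  apply: measurable_forall_fin => i; apply: measurable_ltr_eq => //.
  exact: (measurableT_comp (measurable_tnth i) measurable_snd).
transitivity (P [set w | D (L t w, Eps w)]).
  congr (P _); apply/seteqP; split => w /= H i; move: (H i); by rewrite tnth_mktuple.
rewrite (independent_pair_section independent_joint mD).
apply: eq_integral => w _.
have Lw : 0 <= L t w := subordinator_ge0 hL w t0.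
have mB i : measurable [set e : R | (L t w < e) = x i].
  by apply: measurable_ltr_eq.
have := ieps mB.
rewrite (_ : [set w0 | _] = [set w' | D (L t w, Eps w')]); last first.
  apply/seteqP; split => w' /= H i; move: (H i); by rewrite tnth_mktuple.
move=> ->; rewrite -prodEFin; apply: eq_bigr => i _; exact: threshold_prob.
Qed.

End LFMOTimes.

(** * Mixed coherent systems *)

(** [monotone] compares states differing in one component, so the components are switched one at a
    time: [z s] has the entries of [y] on [s] and those of [x] elsewhere. *)
Lemma monotone_le n (phi : structure_function n) (x y : state n) :
  monotone phi -> (forall i, x i ==> y i) -> phi x ==> phi y.
Proof.
move=> /forallP mono xy.
pose z (s : seq 'I_n) : state n := [ffun j => if j \in s then y j else x j].
suff H s : phi x ==> phi (z s).
  rewrite (_ : y = z (enum 'I_n)); first exact: H.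
  by apply/ffunP => j; rewrite ffunE mem_enum.
elim: s => [|a s /implyP IH]; apply/implyP => phix.
  by rewrite (_ : z [::] = x)//; apply/ffunP => j; rewrite ffunE.
have {IH} := IH phix.
have zE : z s = set_component (z s) a (z s a).
  by apply/ffunP => j; rewrite [RHS]ffunE; case: (eqVneq j a) => [->|].
have zaE : z (a :: s) = set_component (z s) a (y a).
  by apply/ffunP => j; rewrite !ffunE inE; case: (eqVneq j a) => [->|].
rewrite zaE; have : z s a ==> y a by rewrite ffunE; case: ifP => // _; exact: implybb.
rewrite {2}zE; case: (z s a) => [/= ->//|_]; case: (y a) => //.
by move: (mono a) => /forallP/(_ (z s))/implyP.
Qed.

(** The finitely many components alive at [t] all survive to a common [u > t]. At any [v < u] the
    state therefore dominates the one at [t], and by monotonicity the system still works, so the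
    infimum is at least [u]. *)
Lemma system_failure_time_gt (R : realType) d (O : measurableType d)
    (P : probability O R) n (Phi : O -> coherent_system n)
    (T : 'I_n -> {RV P >-> \bar R}) (t : R) w : 0 <= t ->
  (t%:E < system_failure_time Phi T w)%E =
  sval (Phi w) [ffun i => (t%:E < T i w)%E].
Proof.
move=> t0; apply/idP/idP => [tT|work].
  apply/negPn/negP => /negbTE fail; move: tT; apply/negP; rewrite -leNgt.
  by apply: ge_ereal_inf; exists t%:E => //; exists t.
have : \forall u \near t^'+, forall i, (t%:E < T i w)%E -> (u%:E < T i w)%E.
  apply: filter_forall => i; case: (ltP t%:E (T i w)) => [|_]; last by apply: nearW.
  case: (T i w) => [r| |]//; last by move=> _; apply: nearW => u _; exact: ltry.
  rewrite lte_fin => tr; near=> u => _; rewrite lte_fin.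
  by near: u; exact: nbhs_right_lt.
move=> near_t.
have /filter_ex[u [tu uT]] : \forall u \near t^'+,
    t < u /\ forall i, (t%:E < T i w)%E -> (u%:E < T i w)%E.
  near=> u; split; near: u => //; exact: nbhs_right_gt.
apply: (@lt_le_trans _ _ u%:E); first by rewrite lte_fin.
apply: le_ereal_inf_tmp => _ [v /= [v0 fail] <-]; rewrite lee_fin leNgt.
apply/negP => vu; move: fail => /negbT/negP; apply.
have /andP[mono _] := svalP (Phi w).
move: work; apply/implyP; apply: monotone_le => // i; rewrite !ffunE.
apply/implyP => /uT; apply: lt_trans; by rewrite lte_fin.
Unshelve. all: by end_near. Qed.

Lemma probability_finite_partition (R : realType) d (O : measurableType d)
    (P : probability O R) (F : finType) (Z : O -> F) (p : pred F) :
  (forall z, measurable [set w | Z w = z]) ->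
  P [set w | p (Z w)] = (\sum_(z | p z) P [set w | Z w = z])%E.
Proof.
move=> mZ.
have H (s : seq F) : uniq s -> measurable [set w | Z w \in s] /\
    P [set w | Z w \in s] = (\sum_(z <- s) P [set w | Z w = z])%E.
  elim: s => [_|a s IH /= /andP[anots /IH[ms Ps]]].
    rewrite big_nil (_ : [set _ | _] = set0).
      by split; [exact: measurable0|rewrite measure0].
    by apply/seteqP; split => w /=.
  have E : [set w | Z w \in a :: s] = [set w | Z w = a] `|` [set w | Z w \in s].
    apply/seteqP; split => w /=; rewrite inE.
      by case/predU1P; [left|right].
    by case=> [->|->]; rewrite ?eqxx ?orbT.
  rewrite E; split; first exact: measurableU.
  rewrite measureU//; first by rewrite big_cons; congr (_ + _)%E; exact: Ps.
  by apply/seteqP; split => w //= -[-> ]; rewrite (negbTE anots).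
rewrite -big_enum; have [_ <-] := H _ (enum_uniq p); congr (P _).
by apply/seteqP; split => w /=; rewrite mem_enum.
Qed.

Lemma sum_state_compl n (x : state n) : (\sum_i x i + \sum_i ~~ x i = n)%N.
Proof.
rewrite -big_split/= -[RHS]card_ord -sum1_card; apply: eq_bigr => i _.
by case: (x i).
Qed.

Lemma prod_state (R : comRingType) n (x : state n) (p q : R) :
  \prod_i (if x i then p else q) = p ^+ (\sum_i x i) * q ^+ (n - \sum_i x i).
Proof.
have -> : (n - \sum_i x i = \sum_i ~~ x i)%N.
  by rewrite -{1}(sum_state_compl x) addKn.
rewrite -!prodrXr -big_split/=; apply: eq_bigr => i _.
by case: (x i); rewrite /= ?expr1 ?expr0 ?mulr1 ?mul1r.
Qed.

(** A set of vectors of failure times, the form in which both the [LFMO] law and the independence of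
    the random structure can be applied. *)
Definition state_set (R : realType) n (t : R) (x : state n) : set (n.-tuple (\bar R)) :=
  [set y | forall i, (t%:E < tnth y i)%E = x i].

Section MeanStructure.
Context (R : realType) d (O : measurableType d) (P : probability O R).
Context (n : nat) (Phi : O -> coherent_system n).
Hypothesis hPhi : mixed_coherent_system P Phi.

Let mPhi phi : measurable [set w | Phi w = phi].
Proof. by have [p [_ _ /(_ phi)[]]] := hPhi. Qed.

Let works (x : state n) : set O := [set w | sval (Phi w) x].

Let works_probE x :
  P (works x) = (\sum_(phi : coherent_system n | sval phi x) P [set w | Phi w = phi])%E.
Proof.
by rewrite -(probability_finite_partition P (fun phi : coherent_system n => sval phi x) mPhi).
Qed.

Lemma measurable_works x : measurable (works x).
Proof.
rewrite (_ : works x = \bigcup_(phi in [set phi : coherent_system n | sval phi x])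
  [set w | Phi w = phi]).
  by apply: fin_bigcup_measurable => //; exact: finite_finset.
apply/seteqP; split => w /=; first by exists (Phi w).
by case=> phi px pw; rewrite /works/= pw.
Qed.

Definition work_prob (x : state n) : R :=
  fine 'E_P[fun w => (sval (Phi w) x)%:R].

Lemma work_probE x : (work_prob x)%:E = P (works x).
Proof.
rewrite /work_prob (_ : (fun w => _) = \1_(works x)).
  by rewrite expectation_indic ?fineK ?fin_num_measure//; exact: measurable_works.
apply/funext => w; rewrite indicE; congr (nat_of_bool _)%:R.
by apply/idP/idP; rewrite inE.
Qed.

Lemma work_prob_ge0 x : 0 <= work_prob x.
Proof. by rewrite -lee_fin work_probE. Qed.

Lemma work_prob_le1 x : work_prob x <= 1.
Proof. by rewrite -lee_fin work_probE probability_le1//; exact: measurable_works. Qed.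

Lemma mean_structure0_ge0 : 0 <= mean_structure P Phi 0.
Proof.
by rewrite /mean_structure mulr_ge0 ?invr_ge0 ?sumr_ge0// => x _; exact: work_prob_ge0.
Qed.

Lemma mean_structure_full_le1 : mean_structure P Phi n <= 1.
Proof.
rewrite /mean_structure binn invr1 mul1r (big_pred1 [ffun => true]).
  exact: work_prob_le1.
move=> x; have -> : ((\sum_i x i)%N == n) = ((\sum_i ~~ x i)%N == 0%N).
  by rewrite -[X in _ == X](sum_state_compl x) -[X in X == _]addn0 eqn_add2l eq_sym.
rewrite sum_nat_eq0; apply/forallP/eqP => [H|-> i]; last by rewrite ffunE.
by apply/ffunP => i; have := H i; rewrite ffunE /=; case: (x i).
Qed.

Variable T : 'I_n -> {RV P >-> \bar R}.
Hypothesis indep : choice_independent_of_times Phi T.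
Variables (t : R) (t0 : 0 <= t).

Let X (w : O) : state n := [ffun i => (t%:E < T i w)%E].

Local Notation A := (@state_set R n t).

Lemma measurable_state_set x : measurable (A x).
Proof.
apply: measurable_forall_fin => i.
have mb (c : bool) : measurable [set y : \bar R | (t%:E < y)%E = c].
  have mT : measurable [set y : \bar R | (t%:E < y)%E].
    rewrite (_ : [set _ | _] = `]t%:E, +oo[%classic); first exact: emeasurable_itv.
    by apply/seteqP; split => y /=; rewrite in_itv/= andbT.
  case: c; first exact: mT.
  rewrite (_ : [set _ | _] = ~` [set y : \bar R | (t%:E < y)%E]); first exact: measurableC.
  by apply/seteqP; split => y /=; [move=> -> | move/negP/negbTE].
by have := @measurable_tnth _ (\bar R) n i measurableT _ (mb (x i)); rewrite setTI.
Qed.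

Let stateE x : [set w | X w = x] = joint (fun i => T i : O -> \bar R) @^-1` A x.
Proof.
apply/seteqP; split => w /=.
  by move=> <- i; rewrite tnth_mktuple ffunE.
by move=> H; apply/ffunP => i; rewrite ffunE -H tnth_mktuple.
Qed.

Let mstate x : measurable [set w | X w = x].
Proof.
rewrite stateE.
have mT : measurable_fun setT (joint (fun i => T i : O -> \bar R)).
  apply/measurable_fun_tnthP => i.
  by rewrite (_ : _ \o _ = T i)//; apply/funext => w; rewrite /= tnth_mktuple.
by have := mT measurableT _ (measurable_state_set x); rewrite setTI.
Qed.

Lemma system_survival_prob :
  P [set w | (t%:E < system_failure_time Phi T w)%E] =
  (\sum_x (work_prob x)%:E *
     P (joint (fun i => T i : O -> \bar R) @^-1` A x))%E.
Proof.
(* The pair takes finitely many values and its components are independent; summing over the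
   structures first leaves [work_prob x] for each state. *)
pose Z w : coherent_system n * state n := (Phi w, X w).
have ZE z : [set w | Z w = z] =
    [set w | Phi w = z.1] `&` [set w | X w = z.2].
  apply/seteqP; split => w /=; first by move=> <-.
  by case: z => z1 z2 /= [<- <-].
transitivity (P [set w | sval (Z w).1 (Z w).2]).
  by congr (P _); apply/seteqP; split => w /=; rewrite system_failure_time_gt.
rewrite (@probability_finite_partition _ _ _ _ _ Z (fun z => sval z.1 z.2)); last first.
  by move=> z; rewrite ZE; exact: measurableI.
transitivity (\sum_(x : state n) \sum_(phi : coherent_system n | sval phi x)
    P [set w | Phi w = phi] * P (joint (fun i => T i : O -> \bar R) @^-1` A x))%E.
  rewrite (exchange_big_dep xpredT)//= pair_big_dep/=.
  by apply: eq_bigr => -[phi x] _; rewrite ZE/= stateE indep//; exact: measurable_state_set.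
apply: eq_bigr => x _; rewrite -ge0_sume_distrl//.
by rewrite -works_probE -work_probE.
Qed.

End MeanStructure.

(** * Conditioning on the subordinator *)

(** The weight of a state depends only on its number of working components. Grouping by that number
    turns averages over states, such as [mean_structure], into Bernstein coefficients. *)
Lemma sum_states (R : realType) (n : nat) (p : R) (f : state n -> R) :
  \sum_x f x * (p ^+ (\sum_i x i) * (1 - p) ^+ (n - \sum_i x i)) =
  binomial_mean n p
    (fun j => 'C(n, j)%:R^-1 * \sum_(x : state n | (\sum_i x i)%N == j) f x).
Proof.
have lt_sum (x : state n) : (\sum_i x i < n.+1)%N.
  by rewrite ltnS -[leqRHS](sum_state_compl x) leq_addr.
pose h x : 'I_n.+1 := Ordinal (lt_sum x).
rewrite (partition_big h predT)//=; apply: eq_bigr => j _.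
have -> : \sum_(x : state n | (\sum_i x i)%N == j) f x = \sum_(x | h x == j) f x.
  by apply: eq_bigl => x.
have C0 : 'C(n, j)%:R != 0 :> R.
  by rewrite pnatr_eq0 -lt0n bin_gt0 -ltnS.
rewrite mulrCA mulrA mulrA mulrA mulVf// mul1r big_distrr/=.
by apply: eq_bigr => x /eqP <-; rewrite mulrC.
Qed.

Section Survival.
Context (R : realType) dL (OL : measurableType dL) (PL : probability OL R).
Variable L : R -> {RV PL >-> R}.
Context d (O : measurableType d) (P : probability O R) (n : nat).
Variables (Phi : O -> coherent_system n) (T : 'I_n -> {RV P >-> \bar R}).
Hypotheses (hPhi : mixed_coherent_system P Phi) (hT : LFMO L T).
Hypothesis hindep : choice_independent_of_times Phi T.

Lemma same_law_laplace_transform d' (O' : measurableType d') (P' : probability O' R)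
    (L' : R -> {RV P' >-> R}) (b t : R) : same_process_law L L' -> 0 <= t ->
  laplace_transform L' b t = laplace_transform L b t.
Proof.
move=> LL' t0.
have mphi : measurable_fun setT (fun x : R => (expR (- b * x))%:E).
  by apply/measurable_EFinP; apply: measurableT_comp => //; exact: mulrl_measurable.
have ge0 (x : R) : (0 <= (expR (- b * x))%:E)%E by rewrite lee_fin expR_ge0.
rewrite /laplace_transform.
rewrite -[LHS](ge0_integral_distribution (L' t) mphi ge0).
rewrite -[RHS](ge0_integral_distribution (L t) mphi ge0).
apply: eq_measure_integral => A mA _; apply/esym.
have mA1 : measurable [set y : 1.-tuple R | A (tnth y ord0)].
  by have := @measurable_tnth _ R 1 ord0 measurableT A mA; rewrite setTI.
have := @LL' 1 (fun=> t) (fun=> t0) _ mA1.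
rewrite (_ : _ @^-1` _ = L t @^-1` A); last first.
  by apply/funext => w; rewrite /= tnth_mktuple.
by rewrite (_ : _ @^-1` _ = L' t @^-1` A)//; apply/funext => w; rewrite /= tnth_mktuple.
Qed.

(* The Bernstein polynomial of the mean structure, evaluated at [exp (- L t)],
   is the conditional survival probability of the system given [L]. *)
Lemma survival_probability_approx (b e t : R) :
  levy_subordinator L -> 0 < b -> 0 <= t -> 0 <= e ->
  (forall p, 0 <= p <= 1 ->
     `|binomial_mean n p (mean_structure P Phi) - p `^ b| <= e) ->
  exists2 r, P [set w | (t%:E < system_failure_time Phi T w)%E] = r%:E &
    `|r - expR (- laplace_exponent L b * t)| <= e.
Proof.
move=> hL b0 t0 e0 approx.
(* The computation takes place on the auxiliary space; only laws travel back, through [lawT] for the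
   failure times and [LL'] for the subordinator. *)
have [d' [Om [P' [L' [eps [[hL' LL'] heps ieps iLeps lawT]]]]]] := hT.
pose q w := expR (- L' t w).
have q01 w : 0 <= q w <= 1.
  rewrite expR_ge0/= -[leRHS]expR0 ler_expR oppr_le0.
  exact: subordinator_ge0.
have mq : measurable_fun setT q.
  by apply: measurableT_comp => //; apply: measurableT_comp => //; exact: measurable_funPT.
have stateP x : P (joint (fun i => T i : O -> \bar R) @^-1` state_set t x) =
    (\int[P']_w (q w ^+ (\sum_i x i) * (1 - q w) ^+ (n - \sum_i x i))%:E)%E.
  rewrite lawT; last exact: measurable_state_set.
  rewrite -(eq_integral _ _ (fun w _ => congr1 EFin (prod_state x (q w) (1 - q w)))).
  rewrite -(lfmo_state_prob hL' heps ieps iLeps t0 x); congr (P' _).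
  by apply/seteqP; split => w /= H i; move: (H i); rewrite tnth_mktuple.
pose B w := binomial_mean n (q w) (mean_structure P Phi).
have PE : P [set w | (t%:E < system_failure_time Phi T w)%E] = (\int[P']_w (B w)%:E)%E.
  rewrite (system_survival_prob hPhi hindep t0).
  have mg (x : state n) :
      measurable_fun setT (fun w => (q w ^+ (\sum_i x i) * (1 - q w) ^+ (n - \sum_i x i))%:E).
    apply/measurable_EFinP; apply: measurable_funM; apply: measurable_funX => //.
    exact: measurable_funB.
  have g0 (x : state n) w : (0 <= (q w ^+ (\sum_i x i) * (1 - q w) ^+ (n - \sum_i x i))%:E)%E.
    have /andP[? ?] := q01 w.
    by rewrite lee_fin mulr_ge0 ?exprn_ge0 ?subr_ge0.
  under eq_bigr => x _.
    rewrite stateP -ge0_integralZl//; last by rewrite lee_fin work_prob_ge0.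
    over.
  rewrite -ge0_integral_sum//; last 2 first.
  - by move=> x; apply: measurable_funeM.
  - by move=> x w _; rewrite mule_ge0// lee_fin work_prob_ge0.
  apply: eq_integral => w _.
  under eq_bigr do rewrite -EFinM.
  by rewrite sumEFin sum_states.
have powq w : q w `^ b = expR (- b * L' t w).
  by rewrite -expRM; congr expR; ring.
have I : (\int[P']_w (q w `^ b)%:E)%E = (expR (- laplace_exponent L b * t))%:E.
  rewrite -(laplace_transformE hL b0 t0) -(same_law_laplace_transform _ LL' t0).
  by apply: eq_integral => w _; rewrite powq.
(* The bound fits [B] because [approx] keeps it within [e] of a number in the unit interval. *)
have intp (f : Om -> R) : measurable_fun setT f -> (forall w, `|f w| <= 1 + e) ->
    P'.-integrable setT (EFin \o f).
  move=> mf f1; apply: (@le_integrable _ _ _ _ _ measurableT _ (cst (1 + e)%:E)).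
  - exact/measurable_EFinP.
  - by move=> w _ /=; rewrite lee_fin (le_trans (f1 w))// ler_norm.
  - exact: finite_measure_integrable_cst.
have pw01 w : 0 <= q w `^ b <= 1.
  by rewrite powR_ge0 powq -[leRHS]expR0 ler_expR mulNr oppr_le0 mulr_ge0 ?(ltW b0)//
    (subordinator_ge0 hL').
have iq : P'.-integrable setT (fun w => (q w `^ b)%:E).
  apply: intp.
    by rewrite (funext powq); apply: measurableT_comp => //; apply: measurable_funM.
  by move=> w; have /andP[? ?] := pw01 w; rewrite ger0_norm//; lra.
have mB : measurable_fun setT B.
  rewrite /B /binomial_mean; apply: measurable_sum => j.
  by apply: measurable_funM => //; apply: measurable_funM; [apply: measurable_funM|];
    rewrite //; apply: measurable_funX => //; exact: measurable_funB.
have iB : P'.-integrable setT (fun w => (B w)%:E).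
  apply: intp => // w; have := approx _ (q01 w); have /andP[? ?] := pw01 w.
  by rewrite -/(B w) !ler_norml => /andP[? ?]; apply/andP; split; lra.
exists (fine (P [set w | (t%:E < system_failure_time Phi T w)%E])).
  by rewrite fineK// PE; exact: integrable_fin_num.
have D : (fine (P [set w | (t%:E < system_failure_time Phi T w)%E])
      - expR (- laplace_exponent L b * t))%:E =
    (\int[P']_w ((B w)%:E - (q w `^ b)%:E))%E.
  rewrite integralB// I -PE EFinB fineK// PE.
  exact: integrable_fin_num.
rewrite -lee_fin -abse_EFin D.
have mD : measurable_fun setT (fun w => ((B w)%:E - (q w `^ b)%:E)%E).
  exact: measurable_int (integrableB measurableT iB iq).
apply: le_trans (le_abse_integral P' measurableT mD) _.
rewrite -[leRHS]mule1 -(probability_setT P') -(integral_cst P' measurableT).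
apply: ge0_le_integral => //.
- exact: measurableT_comp.
- by move=> w _; rewrite -EFinB abse_EFin lee_fin; exact: approx.
Qed.
End Survival.

(** * Signatures and the beta limit *)

Section PowerSignature.
Context (R : realType) (b : R) d (O : measurableType d) (P : probability O R).
Context (n : nat) (Phi : O -> coherent_system n) (C : R).
Hypotheses (n0 : (0 < n)%N) (hPhi : mixed_coherent_system P Phi).
Hypothesis hC : \sum_(1 <= k < n.+1) C * (n - k + 1)%:R `^ (b - 1) = 1.
Hypothesis hs : forall k, (1 <= k <= n)%N ->
  signature P Phi k = C * (n - k + 1)%:R `^ (b - 1).

Let normalization : C * powsum b n = 1.
Proof.
rewrite -hC /powsum big_distrr/= big_nat_rev/=.
apply: eq_big_nat => k /andP[k1 kn]; rewrite add1n subSS.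
congr (_ * _%:R `^ _); lia.
Qed.

Let mean_structure_powsum j : (j <= n)%N ->
  mean_structure P Phi j = mean_structure P Phi 0 + C * powsum b j.
Proof.
elim: j => [_|j IH jn]; first by rewrite /powsum big_geq// mulr0 addr0.
(* At index [n - j] the signature is the increment of the mean structure from [j] to [j.+1]. *)
have k1 : (1 <= n - j <= n)%N by lia.
have := hs k1; rewrite /signature (_ : n - (n - j) = j)%N ?addn1; last lia.
by rewrite IH ?(ltnW jn)// => /eqP; rewrite subr_eq powsumS => /eqP ->; ring.
Qed.

(* The means at 0 and n differ by 1 and lie in [0, 1], so the former is 0. *)
Lemma mean_structure_ratio j : (j <= n)%N ->
  mean_structure P Phi j = powsum b j / powsum b n.
Proof.
have m0 := mean_structure0_ge0 hPhi; have m1 := mean_structure_full_le1 hPhi.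
rewrite (mean_structure_powsum (leqnn n)) normalization in m1.
move=> /mean_structure_powsum ->.
have -> : mean_structure P Phi 0 = 0 by lra.
have Sn := powsum_gt0 b n0.
have -> : C = (powsum b n)^-1.
  by apply: (mulIf (lt0r_neq0 Sn)); rewrite normalization mulVf// gt_eqF.
by rewrite add0r mulrC.
Qed.

Lemma signature_partial_sum m : (m <= n)%N ->
  \sum_(1 <= k < m.+1) signature P Phi k = 1 - powsum b (n - m) / powsum b n.
Proof.
have Sn := powsum_gt0 b n0.
elim: m => [_|m IH mn]; first by rewrite big_geq// subn0 divff ?subrr// gt_eqF.
rewrite big_nat_recr//= IH ?(ltnW mn)// /signature !mean_structure_ratio; [|lia|lia].
rewrite (_ : n - m.+1 + 1 = n - m)%N; last lia.
ring.
Qed.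

End PowerSignature.

(** * Distribution function of the beta law *)

Lemma is_derive_powR_rev (R : realType) (a q : R) : q < 1 ->
  is_derive q 1 (fun q => (1 - q) `^ a) (- (a * (1 - q) `^ (a - 1))).
Proof.
move=> q1.
have h1 : is_derive q 1 (fun q : R => 1 - q) (-1).
  by rewrite -[X in is_derive _ _ _ X]add0r; apply: is_deriveB.
have h2 : is_derive (1 - q) 1 (fun x : R => x `^ a) (a * (1 - q) `^ (a - 1)).
  by apply: is_derive1_powR; rewrite subr_gt0.
have := @is_derive1_comp _ (fun x : R => x `^ a) (fun q : R => 1 - q) q _ _ h2 h1.
by rewrite mulrN1.
Qed.

Section BetaCdf.
Context (R : realType) (b : R) d (O : measurableType d) (P : probability O R).
Variables (Q : {RV P >-> R}).
Hypotheses (b0 : 0 < b) (hQ : beta1_rv Q b).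

Lemma beta1_cdf_le0 (x : R) : x <= 0 -> cdf Q x = 0%E.
Proof.
move=> x0; rewrite /cdf hQ//; apply: integral0_eq => q /=; rewrite in_itv/= => qx.
rewrite /beta1_pdf patchE memNset//= in_itv/= => /andP[q0 _].
by have := lt_le_trans q0 (le_trans qx x0); rewrite ltxx.
Qed.

(** Stopping at [x < 1] keeps the integral away from 1, where the density is unbounded if
    [b < 1]. *)
Lemma beta1_cdf (x : R) : 0 < x < 1 -> cdf Q x = (1 - (1 - x) `^ b)%:E.
Proof.
move=> /andP[x0 x1]; rewrite /cdf hQ//.
pose g q : R := b * (1 - q) `^ (b - 1).
have E : `]-oo, x]%classic `&` `]0, 1[%classic = `]0, x]%classic :> set R.
  apply/seteqP; split => q /=; rewrite !in_itv/=.
    by move=> [-> /andP[-> _]].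
  by move=> /andP[-> qx]; rewrite qx (le_lt_trans qx).
have der (q : R) : q < 1 -> is_derive q 1 (fun q : R => - (1 - q) `^ b) (g q).
  move=> q1; rewrite -[g q]opprK; apply: is_deriveN; exact: is_derive_powR_rev.
have cg (q : R) : q < 1 -> {for q, continuous g}.
  move=> q1; apply: differentiable_continuous; apply/derivable1_diffP.
  apply: derivableM; first exact: derivable_cst.
  exact: (@ex_derive _ _ _ _ _ _ _ (is_derive_powR_rev (b - 1) q1)).
have cF (q : R) : q < 1 -> {for q, continuous (fun q : R => - (1 - q) `^ b)}.
  move=> q1; apply: differentiable_continuous; apply/derivable1_diffP.
  exact: (@ex_derive _ _ _ _ _ _ _ (der q q1)).
have wg : {within `[0, x], continuous g}.
  apply: continuous_in_subspaceT => q; rewrite inE/= in_itv/= => /andP[_ qx].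
  by apply: cg; exact: le_lt_trans x1.
transitivity (\int[lebesgue_measure]_(q in `]0%R, x]) (g q)%:E)%E.
  rewrite -E integral_mkcondr; apply: eq_integral => q _.
  by rewrite /beta1_pdf !patchE; case: ifP.
rewrite integral_itv_obnd_cbnd; last first.
  apply/measurable_EFinP; apply: (@measurable_funS _ _ _ _ `[0, x]%classic) => //.
    by apply: subset_itvr => //; rewrite bnd_simp.
  exact: subspace_continuous_measurable_fun.
rewrite (@continuous_FTC2 _ g (fun q => - (1 - q) `^ b) 0 x)//.
- by rewrite subr0 powR1 -EFinB; congr EFin; ring.
- split.
  + move=> q; rewrite in_itv/= => /andP[_ qx].
    exact: (@ex_derive _ _ _ _ _ _ _ (der q (lt_trans qx x1))).
  + by apply: cvg_at_right_filter; exact: cF.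
  + by apply: cvg_at_left_filter; exact: cF.
- move=> q; rewrite in_itv/= => /andP[_ qx]; rewrite derive1E.
  exact: (@derive_val _ _ _ _ _ _ _ (der q (lt_trans qx x1))).
Qed.

(** The value is squeezed between 1 and the formula at points [1 - y] just below 1, which avoids
    integrating up to the singularity. *)
Lemma beta1_cdf_ge1 (x : R) : 1 <= x -> cdf Q x = 1%E.
Proof.
move=> x1; apply/eqP; rewrite eq_le cdf_le1/=.
apply/lee_addgt0Pr => e e0.
have [dl dl0 H] := powR_modulus b0 e0.
pose y := Num.min dl (1 / 2).
have y0 : 0 < y by rewrite lt_min dl0/=; lra.
have y2 : y <= 1 / 2 by rewrite ge_min lexx orbT.
have yd : y <= dl by rewrite ge_min lexx.
have ye : y `^ b <= e.
  have := H y 0; rewrite powR0 ?gt_eqF// !subr0 !ger0_norm ?powR_ge0 ?(ltW y0)//.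
  by apply => //; lra.
have yx : 1 - y <= x by lra.
have := cdf_nondecreasing Q yx.
rewrite (@beta1_cdf (1 - y)); last lra.
rewrite subKr => h; apply: (@le_trans _ _ ((1 - y `^ b)%:E + e%:E)%E).
  by rewrite -EFinD lee_fin; lra.
exact: leeD2r.
Qed.

(** Here [y] is [x] clamped to the unit interval, so one formula covers all [x]. The [minn] is the
    number of atoms of [Qn] not exceeding [x]. *)
Lemma beta1_cdf_clip x : exists2 y, 0 <= y <= 1 /\ cdf Q x = (1 - (1 - y) `^ b)%:E &
  forall n, (0 < n)%N ->
    `|(minn n (Num.truncn (n.+1%:R * x)))%:R / n%:R - y| <= n%:R^-1.
Proof.
have [x0|x0] := leP x 0.
  exists 0.
    by rewrite lexx ler01 beta1_cdf_le0// subr0 powR1 subrr.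
  move=> n _; rewrite (_ : Num.truncn _ = 0%N).
    by rewrite minn0 mul0r subr0 normr0 invr_ge0.
  apply/eqP; rewrite -leqn0 leqNgt truncn_gt0 -ltNge.
  by rewrite (le_lt_trans _ ltr01)// mulr_ge0_le0.
have [x1|x1] := leP 1 x.
  exists 1.
    by rewrite lexx ler01 beta1_cdf_ge1// subrr powR0 ?gt_eqF// subr0.
  move=> n n0; rewrite (minn_idPl _).
    by rewrite divff ?subrr ?normr0 ?invr_ge0// pnatr_eq0 -lt0n.
  rewrite truncn_ge_nat; last by rewrite mulr_ge0// ltW.
  have : n%:R <= n.+1%:R :> R by rewrite ler_nat.
  move=> h; apply: le_trans h _; rewrite ler_peMr//.
exists x; first by rewrite (ltW x0) (ltW x1) beta1_cdf ?x0.
move=> n n0; have nR0 : 0 < n%:R :> R by rewrite ltr0n.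
have nx0 : 0 <= n.+1%:R * x by rewrite mulr_ge0// ltW.
(* From [K <= (n + 1) x < K + 1] the difference [K - n x] lies between [x - 1] and [x], hence in
   absolute value below 1. *)
have /andP[] := truncn_itv nx0; set K := Num.truncn _ => K1 K2.
rewrite (minn_idPr _); last first.
  rewrite -ltnS -(ltr_nat R); apply: le_lt_trans K1 _.
  by rewrite gtr_pMr.
rewrite -[X in _ - X](mulfK (lt0r_neq0 nR0)) -mulrBl normrM.
rewrite (gtr0_norm (_ : 0 < n%:R^-1)) ?invr_gt0// ler_piMl ?invr_ge0//.
rewrite -natr1 in K1 K2; rewrite -natr1 in K2.
by rewrite ler_norml; apply/andP; split; nra.
Qed.

End BetaCdf.

(** * Distribution function of the discrete proportions *)

Section DiscreteCdf.
Context (R : realType) d (O : measurableType d) (P : probability O R).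
Variables (Q : {RV P >-> R}) (n : nat) (s : nat -> R).
Hypothesis hs1 : \sum_(1 <= k < n.+1) s k = 1.
Hypothesis hQ : forall k, (1 <= k <= n)%N ->
  P [set w | Q w = k%:R / n.+1%:R] = (s k)%:E.

Let F m : set O := [set w | exists2 k, (1 <= k <= m)%N & Q w = k%:R / n.+1%:R].

Let FS m : F m.+1 = F m `|` [set w | Q w = m.+1%:R / n.+1%:R].
Proof.
apply/seteqP; split => w /=.
  move=> [k /andP[k1 km] Qk]; have [E|km'] := eqVneq k m.+1; first by right; rewrite Qk E.
  by left; exists k => //; lia.
by case=> [[k kb Qk]|Qk]; [exists k|exists m.+1] => //; lia.
Qed.

Let mfib (r : R) : measurable [set w | Q w = r].
Proof.
by rewrite (_ : [set _ | _] = Q @^-1` [set r]).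
Qed.

Let mF m : measurable (F m).
Proof.
elim: m => [|m IH]; last by rewrite FS; exact: measurableU.
by rewrite (_ : F 0 = set0)//; apply/seteqP; split => // w [k]; lia.
Qed.

Let PF m : (m <= n)%N -> P (F m) = (\sum_(1 <= k < m.+1) s k)%:E.
Proof.
elim: m => [_|m IH mn].
  rewrite big_geq// (_ : F 0 = set0) ?measure0//.
  by apply/seteqP; split => // w [k]; lia.
rewrite FS measureU//; last first.
  apply/seteqP; split => // w [[k /andP[k1 km] Qk]] /=.
  rewrite Qk => /(mulIf (lt0r_neq0 _)) H.
  have /eqP : k%:R = m.+1%:R :> R by apply: H; rewrite invr_gt0.
  by rewrite eqr_nat => /eqP E; move: km; rewrite E ltnn.
by rewrite big_nat_recr//= EFinD IH ?(ltnW mn)// hQ.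
Qed.

(** The masses at the points [k / (n + 1)] sum to 1, so the complement of these points is null and
    the event [Q <= x] reduces to the atoms below [x]. *)
Lemma discrete_cdf x :
  cdf Q x = (\sum_(1 <= k < (minn n (Num.truncn (n.+1%:R * x))).+1) s k)%:E.
Proof.
set K := minn _ _; have Kn : (K <= n)%N by exact: geq_minl.
rewrite -PF//.
apply: (@probability_eq_off_null _ _ _ P _ _ (~` F n)) => //.
- by rewrite -[X in measurable X]setTI; exact: measurable_funPT.
- exact: measurableC.
- by rewrite probability_setC// PF// hs1 subee.
have kK k : (1 <= k <= n)%N -> (k%:R / n.+1%:R <= x) = (k <= K)%N.
  case: k => // k /= kn.
  by rewrite leq_min kn/= ler_pdivrMr// mulrC truncn_gt_nat.
apply/seteqP; split => w /= [Qw NFw]; split => //; move/contrapT: (NFw) => [k kb Qk].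
  by exists k => //; move: Qw; rewrite in_itv/= Qk kK//; case/andP: kb => ->.
case: Qw => j /andP[j1 jK] Qj.
by rewrite in_itv/= Qj kK// j1 (leq_trans jK).
Qed.

End DiscreteCdf.

(** * Passage to the limit *)

Lemma laplace_exponent_ge0 (R : realType) d (O : measurableType d)
    (P : probability O R) (L : R -> {RV P >-> R}) (b : R) :
  levy_subordinator L -> 0 < b -> 0 <= laplace_exponent L b.
Proof.
move=> hL b0; have := laplace_transform_le1 hL b0 ler01.
by rewrite laplace_transformE// lee_fin mulr1 -[leRHS]expR0 ler_expR oppr_le0.
Qed.

Lemma exponential_rv_tail (R : realType) d (O : measurableType d)
    (P : probability O R) (e : {RV P >-> \bar R}) (r t : R) :
  0 <= r -> exponential_rv e r -> 0 <= t ->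
  P [set w | (t%:E < e w)%E] = (expR (- r * t))%:E.
Proof.
move=> r0 he t0; have mpre (B : set (\bar R)) : measurable B -> measurable (e @^-1` B).
  by move=> mB; rewrite -[X in measurable X]setTI; exact: measurable_funPT.
have mt : measurable `]t%:E, +oo[%classic by exact: emeasurable_itv.
have -> : [set w | (t%:E < e w)%E] = e @^-1` `]t%:E, +oo[.
  by apply/seteqP; split => w /=; rewrite in_itv/= andbT.
move: he; rewrite /exponential_rv; case: eqVneq => [-> einf|rneq /= he].
  rewrite oppr0 mul0r expR0; apply/eqP; rewrite eq_le probability_le1/=; last exact: mpre.
  rewrite -[leLHS]einf le_measure ?inE//; last 2 first.
  - exact: mpre.
  - by move=> w /= ->; rewrite in_itv/= ltry.
  by apply: (mpre [set +oo%E]); exact: emeasurable_set1.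
transitivity (distribution P e `]t%:E, +oo[) => //.
rewrite he// -exponential_prob_tail//; last by rewrite lt_neqAle eq_sym rneq.
Qed.

Lemma survival_cvg (R : realType) (b : R) (dL : measure_display)
    (OmegaL : measurableType dL) (PL : probability OmegaL R)
    (L : R -> {RV PL >-> R}) (d : nat -> measure_display)
    (Omega : forall n, measurableType (d n)) (P : forall n, probability (Omega n) R)
    (Phi : forall n, Omega n -> coherent_system n)
    (T : forall n, 'I_n -> {RV (P n) >-> \bar R}) (C : nat -> R) (t : R) :
  0 < b -> levy_subordinator L ->
  (forall n, (0 < n)%N -> mixed_coherent_system (P n) (@Phi n)) ->
  (forall n, (0 < n)%N -> LFMO L (@T n)) ->
  (forall n, (0 < n)%N -> choice_independent_of_times (@Phi n) (@T n)) ->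
  (forall n, (0 < n)%N ->
      \sum_(1 <= k < n.+1) C n * (n - k + 1)%:R `^ (b - 1) = 1) ->
  (forall n k, (0 < n)%N -> (1 <= k <= n)%N ->
      signature (P n) (@Phi n) k = C n * (n - k + 1)%:R `^ (b - 1)) ->
  0 <= t ->
  P n [set w | (t%:E < system_failure_time (@Phi n) (@T n) w)%E]
    @[n --> \oo] --> (expR (- laplace_exponent L b * t))%:E.
Proof.
move=> b0 hL hPhi hT hindep hC hs t0.
have near_exp e : 0 < e -> \forall n \near \oo, exists2 r : R,
    P n [set w | (t%:E < system_failure_time (@Phi n) (@T n) w)%E] = r%:E &
    `|r - expR (- laplace_exponent L b * t)| <= e.
  move=> e0; near=> n.
  have n0 : (0 < n)%N by near: n; exact: nbhs_infty_gt.
  apply: (survival_probability_approx (hPhi n n0) (hT n n0) (hindep n n0) hL b0 t0 (ltW e0)).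
  move=> p p01.
  have -> : binomial_mean n p (mean_structure (P n) (@Phi n)) =
      binomial_mean n p (fun j => powsum b j / powsum b n).
    apply: eq_bigr => j _; congr (_ * _).
    apply: (mean_structure_ratio n0 (hPhi n n0) (hC n n0) (fun k => hs n k n0)).
    by rewrite -ltnS.
  move: p p01; near: n; exact: binomial_mean_powsum.
apply: cvg_EFin.
  by apply: filterS (near_exp 1 ltr01) => n [r -> _].
apply/cvgrPdist_le => e e0; apply: filterS (near_exp e e0) => n [r /= -> re].
by rewrite distrC.
Unshelve. all: by end_near. Qed.

Lemma signature_cdf_cvg (R : realType) (b : R) (d : nat -> measure_display)
    (Omega : forall n, measurableType (d n)) (P : forall n, probability (Omega n) R)
    (Q : forall n, {RV (P n) >-> R}) (s : nat -> nat -> R) (x y : R) :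
  0 < b -> 0 <= y <= 1 ->
  (forall n m, (0 < n)%N -> (m <= n)%N ->
    \sum_(1 <= k < m.+1) s n k = 1 - powsum b (n - m) / powsum b n) ->
  (forall n k, (0 < n)%N -> (1 <= k <= n)%N ->
    P n [set w | Q n w = k%:R / n.+1%:R] = (s n k)%:E) ->
  (forall n, (0 < n)%N ->
    `|(minn n (Num.truncn (n.+1%:R * x)))%:R / n%:R - y| <= n%:R^-1) ->
  cdf (Q n) x @[n --> \oo] --> (1 - (1 - y) `^ b)%:E.
Proof.
move=> b0 /andP[y0 y1] hs hQ hK.
have cdfE n : (0 < n)%N -> cdf (Q n) x =
    (1 - powsum b (n - minn n (Num.truncn (n.+1%:R * x))) / powsum b n)%:E.
  move=> n0; have s1 : \sum_(1 <= k < n.+1) s n k = 1.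
    by rewrite hs// subnn {1}/powsum big_geq// mul0r subr0.
  by rewrite (discrete_cdf s1 (fun k => hQ n k n0)) hs ?geq_minl.
apply: cvg_EFin.
  near=> n; rewrite cdfE//; near: n; exact: nbhs_infty_gt.
apply/cvgrPdist_le => e e0.
have e2 : 0 < e / 2 by rewrite divr_gt0.
have [dl dl0 H] := powR_modulus b0 e2.
near=> n.
have n0 : (0 < n)%N by near: n; exact: nbhs_infty_gt.
have nR0 : 0 < n%:R :> R by rewrite ltr0n.
rewrite /= cdfE//=; have := hK n n0; set K := minn _ _ => Kn.
have leKn : (K <= n)%N by exact: geq_minl.
have h1 := powsum_ratio b0 n0 (leq_subr K n).
have En : powsum_error b n <= e / 2 / 2.
  by near: n; apply: powsum_error_near => //; rewrite divr_gt0.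
have nd : n%:R^-1 <= dl.
  rewrite invf_ple ?posrE//; near: n; exact: nbhs_infty_ger.
have E : (n - K)%:R / n%:R = 1 - K%:R / n%:R :> R.
  by rewrite natrB// mulrBl divff// gt_eqF.
have h2 : `|(1 - y) `^ b - (1 - K%:R / n%:R) `^ b| <= e / 2.
  apply: H.
  - by rewrite subr_ge0 y1/= lerBlDr lerDl.
  - rewrite subr_ge0 ler_pdivrMr// mul1r ler_nat leKn/= lerBlDr lerDl.
    by rewrite divr_ge0.
  - rewrite (_ : _ - _ = K%:R / n%:R - y); last ring.
    exact: le_trans Kn nd.
rewrite E in h1.
(* The first bracket is the power sum error and the second the displacement of [K / n] from [y];
   each costs at most [e / 2]. *)
have -> : 1 - (1 - y) `^ b - (1 - powsum b (n - K) / powsum b n) =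
  (powsum b (n - K) / powsum b n - (1 - K%:R / n%:R) `^ b)
  - ((1 - y) `^ b - (1 - K%:R / n%:R) `^ b) by ring.
apply: le_trans (ler_normB _ _) _; lra.
Unshelve. all: by end_near. Qed.

Unset Implicit Arguments.
Set Strict Implicit.
Set Printing Implicit Defensive.

Theorem proposition1 (R : realType) (b : R) (hb : 0 < b)
    (dL : measure_display) (OmegaL : measurableType dL)
    (PL : probability OmegaL R) (L : R -> {RV PL >-> R})
    (hL : levy_subordinator L)
    (d : nat -> measure_display) (Omega : forall n, measurableType (d n))
    (P : forall n, probability (Omega n) R)
    (Phi : forall n, Omega n -> coherent_system n)
    (T : forall n, 'I_n -> {RV (P n) >-> \bar R})
    (hPhi : forall n, (0 < n)%N -> mixed_coherent_system (P n) (@Phi n))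
    (hT : forall n, (0 < n)%N -> LFMO L (@T n))
    (hindep : forall n, (0 < n)%N ->
      choice_independent_of_times (@Phi n) (@T n))
    (C : nat -> R)
    (hC : forall n, (0 < n)%N ->
      \sum_(1 <= k < n.+1) C n * (n - k + 1)%:R `^ (b - 1) = 1)
    (hs : forall n k, (0 < n)%N -> (1 <= k <= n)%N ->
      signature (P n) (@Phi n) k = C n * (n - k + 1)%:R `^ (b - 1)) :
  [/\ forall (d' : measure_display) (Omega' : measurableType d')
        (P' : probability Omega' R) (e : {RV P' >-> \bar R}),
        exponential_rv e (laplace_exponent L b) ->
        forall t : R, 0 < t ->
        P n [set w | (t%:E < system_failure_time (@Phi n) (@T n) w)%E]
          @[n --> \oo] --> P' [set w | (t%:E < e w)%E],
      forall t : R, 0 < t ->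
        P n [set w | (t%:E < system_failure_time (@Phi n) (@T n) w)%E]
          @[n --> \oo] --> (expR (- laplace_exponent L b * t))%:E
    & forall (dQ : nat -> measure_display)
        (OmegaQ : forall n, measurableType (dQ n))
        (PQ : forall n, probability (OmegaQ n) R)
        (Qn : forall n, {RV (PQ n) >-> R})
        (d' : measure_display) (Omega' : measurableType d')
        (P' : probability Omega' R) (Q : {RV P' >-> R}),
        (forall n k, (0 < n)%N -> (1 <= k <= n)%N ->
          PQ n [set w | Qn n w = k%:R / n.+1%:R] =
          (signature (P n) (@Phi n) k)%:E) ->
        beta1_rv Q b ->
        cvg_in_distribution Qn Q].
Proof.
have cvg t : 0 < t -> P n [set w | (t%:E < system_failure_time (@Phi n) (@T n) w)%E]
    @[n --> \oo] --> (expR (- laplace_exponent L b * t))%:E.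
  by move=> /ltW t0; exact: (survival_cvg hb hL hPhi hT hindep hC hs t0).
split=> //.
- move=> d' Omega' P' e he t t0.
  rewrite (exponential_rv_tail (laplace_exponent_ge0 hL hb) he (ltW t0)).
  exact: cvg.
- move=> dQ OmegaQ PQ Qn d' Omega' P' Q hQn hQ x _.
  have [y [y01 ->] hK] := beta1_cdf_clip hb hQ x.
  apply: (signature_cdf_cvg hb y01 _ hQn hK) => n m n0 mn.
  exact: (signature_partial_sum n0 (hPhi n n0) (hC n n0) (fun k => hs n k n0)).
Qed.
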